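(* Let $n\ge 3$, and let $F$ be a real closed field or an algebraically closed field of characteristic $\neq 2$. Let $G=\mathrm{T}_n(F)$ and let $H$ be a group. Then the following are equivalent: (1) $G\equiv H$; (2) $H\cong P\mathrm{T}_n(L)\times Z(H)$ for a field $L\equiv F$, and $Z(H)\equiv F^\times$.
   Context: $\equiv$ denotes elementary equivalence (language of groups for groups, language of rings for fields). $\mathrm{T}_n(F)$ is the group of invertible upper triangular $n\times n$ matrices over $F$, $Z(G)$ is the center of $G$, $P\mathrm{T}_n(L)=\mathrm{T}_n(L)/Z(\mathrm{T}_n(L))$, and $F^\times$ is the multiplicative group of $F$. *)

(* Defs.v *)
From HB Require Import structures.
From mathcomp Require Import all_boot all_order all_algebra.
From mathcomp Require Import boolp.

Set Implicit Arguments.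
Unset Strict Implicit.
Unset Printing Implicit Defensive.

Import GRing.Theory.

(* First-order formulas with equality whose terms, over a set V of free       *)
(* variables, are T V.  A quantifier binds the variable None of option V.     *)
(* Sentences are the formulas over void.                                      *)
Inductive formula (T : Type -> Type) (V : Type) : Type :=
| FEq of T V & T V
| FNot of formula T V
| FAnd of formula T V & formula T V
| FOr of formula T V & formula T V
| FImp of formula T V & formula T V
| FForall of formula T (option V)
| FExists of formula T (option V).

Fixpoint holds (T : Type -> Type) (M : Type)
    (eval : forall V, (V -> M) -> T V -> M)
    (V : Type) (e : V -> M) (f : formula T V) {struct f} : Prop :=
  match f with
  | FEq t u => eval V e t = eval V e u
  | FNot f1 => ~ holds eval e f1
  | FAnd f1 f2 => holds eval e f1 /\ holds eval e f2
  | FOr f1 f2 => holds eval e f1 \/ holds eval e f2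
  | FImp f1 f2 => holds eval e f1 -> holds eval e f2
  | FForall f1 => forall x : M, holds eval (oapp e x) f1
  | FExists f1 => exists x : M, holds eval (oapp e x) f1
  end.

Definition models (T : Type -> Type) (M : Type)
    (eval : forall V, (V -> M) -> T V -> M) (f : formula T void) : Prop :=
  holds eval (of_void M) f.

Inductive group_term (V : Type) : Type :=
| GVar of V
| GOne
| GInv of group_term V
| GMul of group_term V & group_term V.

Fixpoint group_eval (G : groupType) (V : Type) (e : V -> G)
    (t : group_term V) : G :=
  match t with
  | GVar v => e v
  | GOne => 1%g
  | GInv t1 => (group_eval e t1)^-1%g
  | GMul t1 t2 => (group_eval e t1 * group_eval e t2)%g
  end.

Inductive ring_term (V : Type) : Type :=
| RVar of V
| RZero
| ROne
| ROpp of ring_term V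
| RAdd of ring_term V & ring_term V
| RMul of ring_term V & ring_term V.

Fixpoint ring_eval (R : nzRingType) (V : Type) (e : V -> R)
    (t : ring_term V) : R :=
  match t with
  | RVar v => e v
  | RZero => 0%R
  | ROne => 1%R
  | ROpp t1 => (- ring_eval e t1)%R
  | RAdd t1 t2 => (ring_eval e t1 + ring_eval e t2)%R
  | RMul t1 t2 => (ring_eval e t1 * ring_eval e t2)%R
  end.

Definition group_elem_equiv (G H : groupType) : Prop :=
  forall f : formula group_term void,
    models (@group_eval G) f <-> models (@group_eval H) f.

Definition ring_elem_equiv (R S : nzRingType) : Prop :=
  forall f : formula ring_term void,
    models (@ring_eval R) f <-> models (@ring_eval S) f.

Definition group_iso (G H : groupType) : Prop :=
  exists f : {multiplicative G -> H}, bijective f.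

(* rcfType bundles an ordering with the field; being real closed is a         *)
(* property of the bare field.                                                *)
Definition real_closed (F : fieldType) : Prop :=
  exists (R : rcfType) (f : {rmorphism F -> R}), bijective f.

Definition algebraically_closed (F : fieldType) : Prop :=
  GRing.closed_field_axiom F.

Section Center.
Variable G : groupType.
Local Open Scope group_scope.

Definition central : pred G := fun x => `[< forall y : G, commute x y >].

Lemma centralP x : reflect (forall y : G, commute x y) (x \in central).
Proof. exact: asboolP. Qed.

Fact central_group_closed : group_closed central.
Proof.
split=> [|x y /centralP cx /centralP cy].
  by apply/centralP => y; rewrite /commute mul1g mulg1.
apply/centralP => z; have cyV : commute y^-1 z.
  by apply: (mulgI y); rewrite mulVKg mulgA cy mulgK.
by rewrite /commute -mulgA cyV mulgA cx -mulgA.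
Qed.

Record center : predArgType := Center {
  center_val : G;
  center_valP : central center_val
}.

HB.instance Definition _ := [isSub for center_val].
HB.instance Definition _ := [Choice of center by <:].
HB.instance Definition _ :=
  SubChoice_isSubGroup.Build G central center central_group_closed.

Definition same_coset (x y : G) : bool := x^-1 * y \in central.

Fact same_coset_refl : reflexive same_coset.
Proof. by move=> x; rewrite /same_coset mulVg; case: central_group_closed. Qed.

Fact same_coset_sym : symmetric same_coset.
Proof.
have sV x y : same_coset x y -> same_coset y x.
  rewrite /same_coset => /(group_closedV central_group_closed).
  by rewrite invgM invgK.
by move=> x y; apply/idP/idP; apply: sV.
Qed.

Fact same_coset_trans : transitive same_coset.
Proof.
move=> y x z cxy cyz; rewrite /same_coset.
have -> : x^-1 * z = (x^-1 * y) * (y^-1 * z) by rewrite -mulgA mulVKg.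
exact: (group_closedM central_group_closed).
Qed.

Canonical same_coset_equiv :=
  EquivRel same_coset same_coset_refl same_coset_sym same_coset_trans.

Definition center_quotient := {eq_quot same_coset}%qT.

HB.instance Definition _ := Choice.on center_quotient.
HB.instance Definition _ := EqQuotient.on center_quotient.

Let pi (x : G) : center_quotient := (\pi_center_quotient x)%qT.

Definition quot_one : center_quotient := pi 1.
Definition quot_inv (a : center_quotient) : center_quotient := pi (repr a)^-1.
Definition quot_mul (a b : center_quotient) : center_quotient :=
  pi (repr a * repr b).

Fact pi_eqP x y : reflect (pi x = pi y) (same_coset x y).
Proof. by apply: (iffP idP) => [H|/eqmodP //]; apply/eqmodP. Qed.

Fact same_coset_repr x : same_coset (repr (pi x)) x.
Proof. by apply/pi_eqP; rewrite /pi reprK. Qed.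

Fact quot_invE x : quot_inv (pi x) = pi x^-1.
Proof.
apply/pi_eqP; rewrite /same_coset invgK.
have cx : x^-1 * repr (pi x) \in central.
  by rewrite -/(same_coset _ _) same_coset_sym same_coset_repr.
suff -> : repr (pi x) * x^-1 = x^-1 * repr (pi x) by [].
by move/centralP/(_ x): cx; rewrite /commute mulVKg => {1}<-; rewrite mulgK.
Qed.

Fact quot_mulE x y : quot_mul (pi x) (pi y) = pi (x * y).
Proof.
apply/pi_eqP; rewrite /same_coset invgM.
have /centralP cx := same_coset_repr x; have cy := same_coset_repr y.
rewrite -mulgA [X in _ * X]mulgA cx mulgA.
by apply: (group_closedM central_group_closed) => //; apply/centralP.
Qed.

Fact quot_mulA : associative quot_mul.
Proof.
elim/quotW=> x; elim/quotW=> y; elim/quotW=> z.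
by rewrite -!/(pi _) !quot_mulE mulgA.
Qed.

Fact quot_mul1 : left_id quot_one quot_mul.
Proof. by elim/quotW=> x; rewrite -!/(pi _) quot_mulE mul1g. Qed.

Fact quot_mulr1 : right_id quot_one quot_mul.
Proof. by elim/quotW=> x; rewrite -!/(pi _) quot_mulE mulg1. Qed.

Fact quot_mulV : left_inverse quot_one quot_inv quot_mul.
Proof. by elim/quotW=> x; rewrite -!/(pi _) quot_invE quot_mulE mulVg. Qed.

Fact quot_mulrV : right_inverse quot_one quot_inv quot_mul.
Proof. by elim/quotW=> x; rewrite -!/(pi _) quot_invE quot_mulE mulgV. Qed.

HB.instance Definition _ := isGroup.Build center_quotient
  quot_mulA quot_mul1 quot_mulr1 quot_mulV quot_mulrV.

End Center.

Section FieldGroups.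
Variable F : fieldType.
Local Open Scope ring_scope.

Record mul_group : predArgType := MulGroup {
  mul_group_val : F;
  mul_group_valP : mul_group_val != 0
}.

HB.instance Definition _ := [isSub for mul_group_val].
HB.instance Definition _ := [Choice of mul_group by <:].

Fact mul_group_inv_subproof (x : mul_group) : (val x)^-1 != 0.
Proof. by rewrite invr_eq0 (valP x). Qed.

Fact mul_group_mul_subproof (x y : mul_group) : val x * val y != 0.
Proof. by rewrite mulf_neq0 ?(valP x) ?(valP y). Qed.

Definition mul_group_one : mul_group := MulGroup (oner_neq0 F).
Definition mul_group_inv (x : mul_group) : mul_group :=
  MulGroup (mul_group_inv_subproof x).
Definition mul_group_mul (x y : mul_group) : mul_group :=
  MulGroup (mul_group_mul_subproof x y).

Fact mul_group_mulA : associative mul_group_mul.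
Proof. by move=> x y z; apply: val_inj; exact: mulrA. Qed.
Fact mul_group_mul1 : left_id mul_group_one mul_group_mul.
Proof. by move=> x; apply: val_inj; exact: mul1r. Qed.
Fact mul_group_mulr1 : right_id mul_group_one mul_group_mul.
Proof. by move=> x; apply: val_inj; exact: mulr1. Qed.
Fact mul_group_mulV : left_inverse mul_group_one mul_group_inv mul_group_mul.
Proof. by move=> x; apply: val_inj; exact: mulVf (valP x). Qed.
Fact mul_group_mulrV : right_inverse mul_group_one mul_group_inv mul_group_mul.
Proof. by move=> x; apply: val_inj; exact: mulfV (valP x). Qed.

HB.instance Definition _ := isGroup.Build mul_group
  mul_group_mulA mul_group_mul1 mul_group_mulr1 mul_group_mulV mul_group_mulrV.

Variable n : nat.

Definition upper_triangular (A : 'M[F]_n) : bool :=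
  [forall i : 'I_n, forall j : 'I_n, (j < i)%N ==> (A i j == 0)].

Lemma upper_triangularP (A : 'M[F]_n) :
  reflect (forall i j : 'I_n, (j < i)%N -> A i j = 0) (upper_triangular A).
Proof.
apply: (iffP forallP) => H i.
  by move=> j ji; have /forallP/(_ j)/implyP/(_ ji)/eqP := H i.
by apply/forallP => j; apply/implyP => ji; apply/eqP/H.
Qed.

Fact upper_triangular1 : upper_triangular 1%:M.
Proof.
apply/upper_triangularP => i j ji; rewrite !mxE.
by case: eqVneq ji => // ->; rewrite ltnn.
Qed.

Fact upper_triangularM (A B : 'M[F]_n) :
  upper_triangular A -> upper_triangular B -> upper_triangular (A *m B).
Proof.
move=> /upper_triangularP HA /upper_triangularP HB.
apply/upper_triangularP => i j ji; rewrite !mxE big1 // => k _.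
case: (ltnP k i) => [ki|ik]; first by rewrite HA ?mul0r.
by rewrite HB ?mulr0 //; exact: leq_trans ji ik.
Qed.

Fact upper_triangularV (A : 'M[F]_n) :
  upper_triangular A -> A \in unitmx -> upper_triangular (invmx A).
Proof.
move=> /upper_triangularP HA uA; set B := invmx A.
have Adiag i : A i i != 0.
  have : \det A^T != 0 by rewrite det_tr -unitfE -unitmxE.
  rewrite det_trig; last by apply/is_trig_mxP => k l kl; rewrite mxE HA.
  by move/prodf_neq0 => /(_ i isT); rewrite mxE.
apply/upper_triangularP => i j; move: {2}(j : nat) (leqnn j) => m.
elim: m i j => [|m IH] i j jm ji.
all: have := mulVmx uA => /matrixP /(_ i j); rewrite !mxE (bigD1 j) //=.
all: rewrite big1 ?addr0 => [|k nkj].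
all: try by case: eqVneq ji => [->|_ _ /eqP]; rewrite ?ltnn // mulf_eq0
       (negPf (Adiag j)) orbF => /eqP.
all: case: (ltnP k j) => [kj|jk]; last by rewrite HA ?mulr0 //
       ltn_neqAle eq_sym jk andbT.
  by move: (leq_trans kj jm).
by rewrite -/B IH ?mul0r //; [exact: (leq_trans kj jm) | exact: ltn_trans ji].
Qed.

Record tri_group : predArgType := TriGroup {
  tri_group_val : 'M[F]_n;
  tri_group_valP :
    upper_triangular tri_group_val && (tri_group_val \in unitmx)
}.

HB.instance Definition _ := [isSub for tri_group_val].
HB.instance Definition _ := [Choice of tri_group by <:].

Fact tri_group_one_subproof :
  upper_triangular 1%:M && ((1%:M : 'M[F]_n) \in unitmx).
Proof. by rewrite upper_triangular1 unitmx1. Qed.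

Fact tri_group_inv_subproof (A : tri_group) :
  upper_triangular (invmx (val A)) && (invmx (val A) \in unitmx).
Proof.
by case/andP: (valP A) => tA uA; rewrite upper_triangularV // unitmx_inv.
Qed.

Fact tri_group_mul_subproof (A B : tri_group) :
  upper_triangular (val A *m val B) && (val A *m val B \in unitmx).
Proof.
case/andP: (valP A) => tA uA; case/andP: (valP B) => tB uB.
by rewrite upper_triangularM // unitmx_mul uA.
Qed.

Definition tri_group_one : tri_group := TriGroup tri_group_one_subproof.
Definition tri_group_inv (A : tri_group) : tri_group :=
  TriGroup (tri_group_inv_subproof A).
Definition tri_group_mul (A B : tri_group) : tri_group :=
  TriGroup (tri_group_mul_subproof A B).

Fact tri_group_mulA : associative tri_group_mul.
Proof. by move=> A B C; apply: val_inj; exact: mulmxA. Qed.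
Fact tri_group_mul1 : left_id tri_group_one tri_group_mul.
Proof. by move=> A; apply: val_inj; exact: mul1mx. Qed.
Fact tri_group_mulr1 : right_id tri_group_one tri_group_mul.
Proof. by move=> A; apply: val_inj; exact: mulmx1. Qed.
Fact tri_group_mulV : left_inverse tri_group_one tri_group_inv tri_group_mul.
Proof. by move=> A; apply: val_inj; apply: mulVmx; case/andP: (valP A). Qed.
Fact tri_group_mulrV : right_inverse tri_group_one tri_group_inv tri_group_mul.
Proof. by move=> A; apply: val_inj; apply: mulmxV; case/andP: (valP A). Qed.

HB.instance Definition _ := isGroup.Build tri_group
  tri_group_mulA tri_group_mul1 tri_group_mulr1 tri_group_mulV tri_group_mulrV.

End FieldGroups.

(* Main.v *)
Require Import Defs.
From HB Require Import structures.
From mathcomp Require Import all_boot all_order all_algebra.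
From mathcomp Require Import boolp classical_sets zify.

(** Two facts about a field F of characteristic not 2 do most of the work.
    Every class of T_n(F) modulo scalars contains exactly one matrix A with
    A_11 = 1, so PT_n(F) is interpreted in F by the entries of that matrix, and
    A |-> (class of A, A_11) is an isomorphism of T_n(F) with PT_n(F) x F^*.

    From (2) to (1): the interpretation turns L == F into PT_n(L) == PT_n(F)
    ([projective_tri_elem_equiv]), elementary equivalence is preserved by direct
    products ([group_elem_equiv_prod]), and the product decomposition of T_n(F)
    concludes ([equiv_of_iso]).

    From (1) to (2): the field is recovered inside the group.  The commutators
    that centralize all commutators form, in T_n(F), the root subgroup of the
    matrices 1 + a e_1n.  Conjugation by g multiplies a by g_nn / g_11, so the
    choice of an element u <> 1 makes this subgroup a copy of F with unit u and
    product u^g * u^h = u^(gh).  No other choice enters the definition, and all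
    choices of u give a copy of F; hence in H == T_n(F) each choice gives a field L
    with L == F ([corner_elem_equiv]).

    For x_i = 1 + e_1i and y_k = 1 + e_kn, the word
    y_k^-1 x_i^g y_k (x_i^g)^-1 is the matrix 1 + (g_ik / g_11) e_1n
    ([tri_coordinatizable]).  So the existence of elements x_i, y_k for which these
    words are the entries of a homomorphism with central kernel onto the normalized
    triangular matrices over the field above is a first-order property of T_n(F).
    In H it says that H / Z(H) is isomorphic to PT_n(L).

    It remains to split Z(H) off as a direct factor, that is, to find a
    homomorphism H -> Z(H) that is the identity on Z(H)
    ([coordinatizable_decomposition]).  For each m, a central product of m
    commutators of T_n(F) is 1 because its first diagonal entry is 1, so Z(H) meets
    the derived group of H trivially.  If F is algebraically closed, Z(H) is
    divisible, and divisible central subgroups that avoid the derived group are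
    retracts, by Zorn's lemma ([divisible_retraction]).  If F is real closed, Z(H)
    is the product of the divisible group of its squares and of a group {1, e}; -1
    is not a square in F, so e is not a product of squares of H, and {1, e} is a
    retract too ([involution_retraction]).  The product of the two retractions is
    the one sought. *)

Set Implicit Arguments.
Unset Strict Implicit.
Unset Printing Implicit Defensive.

Import GRing.Theory.

(** * First-order definability *)

(** Groups are interpreted in rings and rings in groups, so the two signatures are
    instances of one notion.  [var] and [term_map] give the renaming of variables
    that de Bruijn quantifiers require. *)
Record language := Language {
  term : Type -> Type;
  structure : Type;
  carrier : structure -> Type;
  value : forall (k : structure) (V : Type), (V -> carrier k) -> term V -> carrier k;
  var : forall V : Type, V -> term V;
  term_map : forall V W : Type, (V -> W) -> term V -> term W;
  valueV : forall k V (e : V -> carrier k) v, value e (var v) = e v;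
  value_map : forall k V W (s : V -> W) (e : W -> carrier k) t,
    value e (term_map s t) = value (e \o s) t
}.

Section Definable.
Variable Lg : language.
Implicit Types (V W : Type) (k : structure Lg).
Local Notation sat k e f := (holds (@value Lg k) e f).

Fixpoint formula_map V W (s : V -> W) (f : formula (term Lg) V) :
    formula (term Lg) W :=
  match f with
  | FEq t u => FEq (term_map s t) (term_map s u)
  | FNot f1 => FNot (formula_map s f1)
  | FAnd f1 f2 => FAnd (formula_map s f1) (formula_map s f2)
  | FOr f1 f2 => FOr (formula_map s f1) (formula_map s f2)
  | FImp f1 f2 => FImp (formula_map s f1) (formula_map s f2)
  | FForall f1 => FForall (formula_map (omap s) f1)
  | FExists f1 => FExists (formula_map (omap s) f1)
  end.

Lemma sat_map k V W (s : V -> W) f (e : W -> carrier k) :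
  sat k e (formula_map s f) <-> sat k (e \o s) f.
Proof.
have Eo V1 W1 (s1 : V1 -> W1) (e1 : W1 -> carrier k) x :
    oapp e1 x \o omap s1 = oapp (e1 \o s1) x by apply/funext => -[].
elim: f W s e => {V} [V t u|V f IH|V f IHf g IHg|V f IHf g IHg|V f IHf g IHg
                     |V f IH|V f IH] W s e /=.
- by rewrite !value_map.
- by split=> nf /(IH W s e).
- by split=> -[/(IHf W s e) ? /(IHg W s e)].
- by split=> -[/(IHf W s e)|/(IHg W s e)]; [left|right|left|right].
- by split=> fg /(IHf W s e)/fg/(IHg W s e).
- have IHx x : sat k (oapp e x) (formula_map (omap s) f) <->
      sat k (oapp (e \o s) x) f by rewrite -Eo; exact: IH.
  by split=> H x; apply/IHx; apply: H.
have IHx x : sat k (oapp e x) (formula_map (omap s) f) <->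
    sat k (oapp (e \o s) x) f by rewrite -Eo; exact: IH.
by split=> -[x] Hx; exists x; apply/IHx.
Qed.

(** A property of tuples, given for all structures of a language at once, is
    definable when one formula expresses it in all of them.  Definability is proved
    from closure properties of such predicates, so that no formula is ever
    written. *)
Definition definable V (P : forall k, (V -> carrier k) -> Prop) :=
  exists f, forall k e, P k e <-> sat k e f.

Definition term_definable V (t : forall k, (V -> carrier k) -> carrier k) :=
  exists s, forall k (e : V -> carrier k), t k e = value e s.

Lemma term_definable_var V (v : V) : term_definable (fun k e => e v).
Proof. by exists (var _ v) => k e; rewrite valueV. Qed.

Lemma definable_ext V (P Q : forall k, (V -> carrier k) -> Prop) :
  definable P -> (forall k e, Q k e <-> P k e) -> definable Q.
Proof. by case=> f Hf H; exists f => k e; rewrite H Hf. Qed.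

Lemma definable_map V W (s : V -> W) P :
  definable P -> definable (fun k (e : W -> carrier k) => P k (e \o s)).
Proof.
by case=> f Hf; exists (formula_map s f) => k e; rewrite Hf; split=> /sat_map.
Qed.

Lemma definable_eq V (t u : forall k, (V -> carrier k) -> carrier k) :
  term_definable t -> term_definable u ->
  definable (fun k e => t k e = u k e).
Proof. by case=> s Hs [r Hr]; exists (FEq s r) => k e; rewrite Hs Hr. Qed.

Lemma definable_not V (P : forall k, (V -> carrier k) -> Prop) :
  definable P -> definable (fun k e => ~ P k e).
Proof. by case=> f Hf; exists (FNot f) => k e; rewrite Hf. Qed.

Lemma definable_and V (P Q : forall k, (V -> carrier k) -> Prop) :
  definable P -> definable Q -> definable (fun k e => P k e /\ Q k e).
Proof. by case=> f Hf [g Hg]; exists (FAnd f g) => k e; rewrite Hf Hg. Qed.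

Lemma definable_or V (P Q : forall k, (V -> carrier k) -> Prop) :
  definable P -> definable Q -> definable (fun k e => P k e \/ Q k e).
Proof. by case=> f Hf [g Hg]; exists (FOr f g) => k e; rewrite Hf Hg. Qed.

Lemma definable_imp V (P Q : forall k, (V -> carrier k) -> Prop) :
  definable P -> definable Q -> definable (fun k e => P k e -> Q k e).
Proof. by case=> f Hf [g Hg]; exists (FImp f g) => k e; rewrite Hf Hg. Qed.

Lemma definable_forall V (P : forall k, (V -> carrier k) -> carrier k -> Prop) :
  definable (fun k (e : option V -> carrier k) => P k (e \o some) (e None)) ->
  definable (fun k e => forall x, P k e x).
Proof.
case=> f Hf; exists (FForall f) => k e /=.
by split=> H x; [apply/Hf/H | have /Hf := H x].
Qed.

Lemma definable_exists V (P : forall k, (V -> carrier k) -> carrier k -> Prop) :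
  definable (fun k (e : option V -> carrier k) => P k (e \o some) (e None)) ->
  definable (fun k e => exists x, P k e x).
Proof.
case=> f Hf; exists (FExists f) => k e /=.
by split=> -[x] H; exists x; [apply/Hf | move/Hf: H].
Qed.

Lemma definable_true V : definable (fun k (e : V -> carrier k) => True).
Proof.
by exists (FForall (FEq (var _ None) (var _ None))) => k e; split=> // _ x.
Qed.

Lemma definable_cond V (b : bool) (P : forall k, (V -> carrier k) -> Prop) :
  definable P -> definable (fun k e => b -> P k e).
Proof.
case: b => dP; first by apply: (definable_ext dP) => k e; split=> // H; apply: H.
by apply: (definable_ext (@definable_true V)).
Qed.

Lemma definable_all V (I : finType) (P : I -> forall k, (V -> carrier k) -> Prop) :
  (forall i, definable (P i)) -> definable (fun k e => forall i, P i k e).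
Proof.
move=> dP.
have Hs (s : seq I) : definable (fun k e => forall i, i \in s -> P i k e).
  elim: s => [|j s IH].
    by apply: (definable_ext (@definable_true V)).
  apply: (definable_ext (definable_and (dP j) IH)) => k e; split.
    by move=> H; split=> [|i si]; apply: H; rewrite inE ?eqxx ?si ?orbT.
  by case=> Hj H i; rewrite inE => /predU1P [->|/H].
apply: (definable_ext (Hs (enum I))) => k e.
by split=> H i; [move=> _|]; apply: H; rewrite mem_enum.
Qed.

(** A block of n quantifiers, needed since the number of coordinates depends on the
    size of the matrices: the first component is quantified separately, and the
    remaining ones by induction. *)
Lemma definable_exists_tuple n V
    (P : forall k, (V -> carrier k) -> ('I_n -> carrier k) -> Prop) :
  definable (fun k (e : V + 'I_n -> carrier k) => P k (e \o inl) (e \o inr)) ->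
  definable (fun k e => exists x, P k e x).
Proof.
elim: n V P => [|n IH] V P dP.
  pose s (v : V + 'I_0) := match v with
    inl v => v | inr i => False_rect V (not_false_is_true (ltn_ord i)) end.
  apply: (definable_ext (definable_map s dP)) => k e.
  have E (x : 'I_0 -> carrier k) : x = (e \o s) \o inr.
    by apply/funext => i; have := ltn_ord i.
  by split=> [[x]|H]; [rewrite (E x) | exists ((e \o s) \o inr)].
pose s (v : V + 'I_n.+1) : option V + 'I_n := match v with
    inl v => inl (Some v)
  | inr i => if unlift ord0 i is Some j then inr j else inl None end.
pose cons k (y : carrier k) (x : 'I_n -> carrier k) (i : 'I_n.+1) :=
  if unlift ord0 i is Some j then x j else y.
have dQ : definable (fun k e => exists x : 'I_n -> carrier k,
    P k (e \o some) (cons k (e None) x)).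
  apply: IH; apply: (definable_ext (definable_map s dP)) => k e.
  suff -> : cons k (e (inl None)) (e \o inr) = (e \o s) \o inr by [].
  by apply/funext => i; rewrite /cons /s /=; case: unliftP.
apply: (definable_ext (@definable_exists V
  (fun k e y => exists x, P k e (cons k y x)) dQ)).
move=> k e; split=> [[x Px]|[y [x Px]]]; last by exists (cons k y x).
exists (x ord0), (x \o lift ord0).
suff -> : cons k (x ord0) (x \o lift ord0) = x by [].
by apply/funext => i; rewrite /cons; case: unliftP => [j|] ->.
Qed.

Lemma definable_exists_fin (I : finType) V
    (P : forall k, (V -> carrier k) -> (I -> carrier k) -> Prop) :
  definable (fun k (e : V + I -> carrier k) => P k (e \o inl) (e \o inr)) ->
  definable (fun k e => exists x, P k e x).
Proof.
move=> dP.
pose s (v : V + I) : V + 'I_#|I| := match v with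
    inl v => inl v | inr i => inr (enum_rank i) end.
apply: (definable_ext (@definable_exists_tuple #|I| _
   (fun k e x => P k e (x \o enum_rank)) _)).
  by apply: (definable_ext (definable_map s dP)).
move=> k e; split=> -[x Px]; last by exists (x \o enum_rank).
exists (x \o enum_val).
suff -> : (x \o enum_val) \o enum_rank = x by [].
by apply/funext => i /=; rewrite enum_rankK.
Qed.

Lemma definable_forall_fin (I : finType) V
    (P : forall k, (V -> carrier k) -> (I -> carrier k) -> Prop) :
  definable (fun k (e : V + I -> carrier k) => P k (e \o inl) (e \o inr)) ->
  definable (fun k e => forall x, P k e x).
Proof.
move=> /definable_not dP.
have /definable_not dQ := @definable_exists_fin I V (fun k e x => ~ P k e x) dP.
apply: (definable_ext dQ) => k e; split=> [H [x]|]; first exact.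
by move=> /forallNP H x; apply: contrapT.
Qed.

Lemma term_definable_big V I (r : seq I) (op : forall k, carrier k -> carrier k -> carrier k)
    (idx : forall k, carrier k) (F : I -> forall k, (V -> carrier k) -> carrier k) :
  term_definable (fun k (e : V -> carrier k) => idx k) ->
  (forall t u : forall k, (V -> carrier k) -> carrier k,
    term_definable t -> term_definable u ->
    term_definable (fun k e => op k (t k e) (u k e))) ->
  (forall i, term_definable (F i)) ->
  term_definable (fun k e => \big[op k/idx k]_(i <- r) F i k e).
Proof.
move=> d1 dop dF; elim: r => [|i r [u Hu]].
  by case: d1 => s Hs; exists s => k e; rewrite big_nil.
have [s Hs] := dop _ _ (dF i) (ex_intro _ u Hu).
by exists s => k e; rewrite big_cons -Hs.
Qed.

(** Substituting terms in a formula amounts to quantifying over their values. *)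
Lemma definable_subst V (J : finType) (P : forall k, (J -> carrier k) -> Prop)
    (t : J -> forall k, (V -> carrier k) -> carrier k) :
  definable P -> (forall j, term_definable (t j)) ->
  definable (fun k e => P k (fun j => t j k e)).
Proof.
move=> dP dt.
apply: (@definable_ext _ (fun k e => exists z : J -> carrier k,
  (forall j, z j = t j k e) /\ P k z)).
  apply: definable_exists_fin; apply: definable_and.
    apply: definable_all => j; apply: definable_eq; first exact: term_definable_var.
    have [s Hs] := dt j; exists (term_map inl s) => k e.
    by rewrite Hs value_map.
  exact: definable_map inr _ dP.
move=> k e; split=> [Pt|[z [zt]]]; first by eexists; split; last exact: Pt.
by suff -> : z = (fun j => t j k e) by []; apply/funext.
Qed.

Definition elem_equiv k1 k2 :=
  forall f : formula (term Lg) void, models (@value Lg k1) f <-> models (@value Lg k2) f.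

Lemma elem_equiv_transfer k1 k2 (P : structure Lg -> Prop) :
  elem_equiv k1 k2 -> definable (fun k (e : void -> carrier k) => P k) ->
  P k1 <-> P k2.
Proof.
by move=> E [f Hf]; rewrite (Hf k1 (of_void _)) (Hf k2 (of_void _)); apply: E.
Qed.

End Definable.

(** An interpretation with [W]-indexed constants: an element of a structure [M] is
    coded by an [I]-indexed tuple [C m] of elements of a structure [N].  The relation
    [Rel] singles out the data to which the interpretation applies. *)
Section Interpretation.
Variables (L1 L2 : language) (W : Type) (I : finType).
Implicit Types (N : structure L1) (M : structure L2).

Definition coords V M N (e : V -> carrier M) (C : carrier M -> I -> carrier N)
  (vi : V * I) : carrier N := C (e vi.1) vi.2.

Variable Rel : forall N (p : W -> carrier N) M (C : carrier M -> I -> carrier N), Prop.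

Variable dom : forall N, (W -> carrier N) -> (I -> carrier N) -> Prop.
Hypothesis dom_definable : definable (fun N (e : W + I -> carrier N) =>
  dom (e \o inl) (e \o inr)).
Hypothesis domP : forall N p M C, @Rel N p M C ->
  forall x, dom p x <-> exists m, x = C m.

Hypothesis term_interp : forall V (t : term L2 V),
  exists D : forall N, (W -> carrier N) -> (V * I -> carrier N) ->
      (I -> carrier N) -> Prop,
    definable (fun N (e : W + (V * I + I) -> carrier N) =>
      D N (e \o inl) (e \o inr \o inl) (e \o inr \o inr)) /\
    forall N p M C, @Rel N p M C -> forall e m,
      D N p (coords e C) (C m) <-> value e t = m.

(** The usual translation of formulas: quantifiers over [M] become quantifiers over
    the tuples of the definable set [dom] of codes, and an equation between terms
    says that both have the same value. *)
Lemma formula_interp V (f : formula (term L2) V) :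
  exists D : forall N, (W -> carrier N) -> (V * I -> carrier N) -> Prop,
    definable (fun N (e : W + V * I -> carrier N) => D N (e \o inl) (e \o inr)) /\
    forall N p M C, @Rel N p M C -> forall e,
      D N p (coords e C) <-> holds (@value L2 M) e f.
Proof.
pose ext V N (x : V * I -> carrier N) (y : I -> carrier N) (vi : option V * I) :=
  match vi.1 with Some v => x (v, vi.2) | None => y vi.2 end.
have extE V0 N M C (e : V0 -> carrier M) (m : carrier M) :
    ext V0 N (coords e C) (C m) = coords (oapp e m) C.
  by apply/funext => -[[v|] i].
pose s V0 (v : W + option V0 * I) : (W + V0 * I) + I := match v with
   inl w => inl (inl w) | inr (Some v, i) => inl (inr (v, i))
 | inr (None, i) => inr i end.
have sE V0 N (e : (W + V0 * I) + I -> carrier N) :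
    (e \o s V0) \o inr = ext V0 N (e \o inl \o inr) (e \o inr).
  by apply/funext => -[[v|] i].
pose s2 V0 (v : W + I) : (W + V0 * I) + I := match v with
   inl w => inl (inl w) | inr i => inr i end.
elim: f => {V} [V t u|V f [D [dD HD]]|V f [D [dD HD]] g [E [dE HE]]
   |V f [D [dD HD]] g [E [dE HE]] |V f [D [dD HD]] g [E [dE HE]]
   |V f [D [dD HD]]|V f [D [dD HD]]].
- have [D [dD HD]] := term_interp t; have [E [dE HE]] := term_interp u.
  pose s3 (v : W + (V * I + I)) : (W + V * I) + I := match v with
    inl w => inl (inl w) | inr (inl v) => inl (inr v) | inr (inr i) => inr i end.
  exists (fun N p x => exists y, dom p y /\ (D N p x y /\ E N p x y)); split.
    apply: definable_exists_fin; apply: definable_and; last apply: definable_and.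
    + exact: (definable_ext (definable_map (s2 V) dom_definable)).
    + exact: (definable_ext (definable_map s3 dD)).
    + exact: (definable_ext (definable_map s3 dE)).
  move=> N p M C R e; split.
    by move=> [y [/(domP R) [m ->]]] [/(HD _ _ _ _ R) /= -> /(HE _ _ _ _ R)].
  move=> /= tu; exists (C (value e t)); split; first by apply/(domP R); eexists.
  by split; [apply/(HD _ _ _ _ R)|apply/(HE _ _ _ _ R)].
- exists (fun N p x => ~ D N p x); split; first exact: definable_not.
  by move=> N p M C R e /=; rewrite (HD _ _ _ _ R).
- exists (fun N p x => D N p x /\ E N p x); split; first exact: definable_and.
  by move=> N p M C R e /=; rewrite (HD _ _ _ _ R) (HE _ _ _ _ R).
- exists (fun N p x => D N p x \/ E N p x); split; first exact: definable_or.
  by move=> N p M C R e /=; rewrite (HD _ _ _ _ R) (HE _ _ _ _ R).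
- exists (fun N p x => D N p x -> E N p x); split; first exact: definable_imp.
  by move=> N p M C R e /=; rewrite (HD _ _ _ _ R) (HE _ _ _ _ R).
- exists (fun N p x => forall y, dom p y -> D N p (ext V N x y)); split.
    apply: definable_forall_fin; apply: definable_imp.
      exact: (definable_ext (definable_map (s2 V) dom_definable)).
    by apply: (definable_ext (definable_map (@s V) dD)) => N e; rewrite sE.
  move=> N p M C R e /=; split=> [H m|H y /(domP R) [m ->]].
    by apply/(HD _ _ _ _ R); rewrite -extE; apply: H; apply/(domP R); exists m.
  by rewrite extE; apply/(HD _ _ _ _ R).
exists (fun N p x => exists y, dom p y /\ D N p (ext V N x y)); split.
  apply: definable_exists_fin; apply: definable_and.
    exact: (definable_ext (definable_map (s2 V) dom_definable)).
  by apply: (definable_ext (definable_map (@s V) dD)) => N e; rewrite sE.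
move=> N p M C R e /=; split=> [[y [/(domP R) [m ->]]]|[m Hm]].
  by rewrite extE => /(HD _ _ _ _ R) Hm; exists m.
exists (C m); split; first by apply/(domP R); exists m.
by rewrite extE; apply/(HD _ _ _ _ R).
Qed.

Lemma sentence_interp (f : formula (term L2) void) :
  exists D : forall N, (W -> carrier N) -> Prop,
    definable D /\ forall N p M C, @Rel N p M C ->
      D N p <-> models (@value L2 M) f.
Proof.
have [D [dD HD]] := formula_interp f.
pose o N (vi : void * I) : carrier N := of_void _ vi.1.
pose s (v : W + void * I) : W := match v with
  inl w => w | inr vi => of_void _ vi.1 end.
exists (fun N p => D N p (o N)); split.
  apply: (definable_ext (definable_map s dD)) => N e.
  suff -> : o N = (e \o s) \o inr by [].
  by apply/funext => -[[]].
move=> N p M C R; rewrite -[models _ _](HD _ _ _ _ R (of_void _)).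
suff -> : o N = coords (of_void _) C by [].
by apply/funext => -[[]].
Qed.

End Interpretation.

(** * Definable predicates of groups and rings *)

Section Languages.
Local Open Scope group_scope.

Fixpoint group_term_map V W (s : V -> W) (t : group_term V) : group_term W :=
  match t with
  | GVar v => GVar (s v)
  | GOne => GOne W
  | GInv t1 => GInv (group_term_map s t1)
  | GMul t1 t2 => GMul (group_term_map s t1) (group_term_map s t2)
  end.

Fact group_eval_map (G : groupType) V W (s : V -> W) (e : W -> G) t :
  group_eval e (group_term_map s t) = group_eval (e \o s) t.
Proof. by elim: t => //= [t ->|t -> u ->]. Qed.

Definition group_language : language :=
  @Language group_term groupType (fun G => G : Type) group_eval GVar group_term_map
    (fun G V e v => erefl) group_eval_map.

Fixpoint ring_term_map V W (s : V -> W) (t : ring_term V) : ring_term W :=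
  match t with
  | RVar v => RVar (s v)
  | RZero => RZero W
  | ROne => ROne W
  | ROpp t1 => ROpp (ring_term_map s t1)
  | RAdd t1 t2 => RAdd (ring_term_map s t1) (ring_term_map s t2)
  | RMul t1 t2 => RMul (ring_term_map s t1) (ring_term_map s t2)
  end.

Fact ring_eval_map (R : nzRingType) V W (s : V -> W) (e : W -> R) t :
  ring_eval e (ring_term_map s t) = ring_eval (e \o s) t.
Proof. by elim: t => //= [t ->|t -> u ->|t -> u ->]. Qed.

Definition ring_language : language :=
  @Language ring_term nzRingType (fun R => R : Type) ring_eval RVar ring_term_map
    (fun G V e v => erefl) ring_eval_map.

Definition gdefinable V (P : forall G : groupType, (V -> G) -> Prop) :=
  @definable group_language V P.
Definition gterm V (t : forall G : groupType, (V -> G) -> G) :=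
  @term_definable group_language V t.

Section GroupTerms.
Variable V : Type.
Implicit Types t u : forall G : groupType, (V -> G) -> G.

Lemma gterm_var (v : V) : gterm (fun G e => e v).
Proof. exact: (@term_definable_var group_language). Qed.

Lemma gterm1 : @gterm V (fun G e => 1).
Proof. by exists (GOne V). Qed.

Lemma gtermV t : gterm t -> gterm (fun G e => (t G e)^-1).
Proof. by case=> s Hs; exists (GInv s) => G e; rewrite Hs. Qed.

Lemma gtermM t u : gterm t -> gterm u -> gterm (fun G e => t G e * u G e).
Proof. by case=> s Hs [r Hr]; exists (GMul s r) => G e; rewrite Hs Hr. Qed.

Lemma gtermX n t : gterm t -> gterm (fun G e => t G e ^+ n).
Proof.
move=> dt; elim: n => [|n [s Hs]]; first exact: gterm1.
have [r Hr] := gtermM dt (ex_intro _ s Hs).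
by exists r => G e; rewrite -Hr expgS.
Qed.

Lemma gterm_prod I (r : seq I) (F : I -> forall G : groupType, (V -> G) -> G) :
  (forall i, gterm (F i)) -> gterm (fun G e => \prod_(i <- r) F i G e).
Proof.
move=> dF; apply: (@term_definable_big group_language V I r (fun G => @monoid.mul G)
  (fun G => 1) F) => //; [exact: gterm1 | exact: gtermM].
Qed.

End GroupTerms.
End Languages.

Definition rdefinable V (P : forall R : nzRingType, (V -> R) -> Prop) :=
  @definable ring_language V P.
Definition rterm V (t : forall R : nzRingType, (V -> R) -> R) :=
  @term_definable ring_language V t.

Section RingTerms.
Local Open Scope ring_scope.
Variable V : Type.
Implicit Types t u : forall R : nzRingType, (V -> R) -> R.

Lemma rterm_var (v : V) : rterm (fun R e => e v).
Proof. exact: (@term_definable_var ring_language). Qed.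

Lemma rterm0 : @rterm V (fun R e => 0).
Proof. by exists (RZero V). Qed.

Lemma rterm1 : @rterm V (fun R e => 1).
Proof. by exists (ROne V). Qed.

Lemma rtermD t u : rterm t -> rterm u -> rterm (fun R e => t R e + u R e).
Proof. by case=> s Hs [r Hr]; exists (RAdd s r) => R e; rewrite Hs Hr. Qed.

Lemma rtermM t u : rterm t -> rterm u -> rterm (fun R e => t R e * u R e).
Proof. by case=> s Hs [r Hr]; exists (RMul s r) => R e; rewrite Hs Hr. Qed.

Lemma rterm_nat n : @rterm V (fun R e => n%:R).
Proof.
elim: n => [|n [s Hs]]; first exact: rterm0.
have [r Hr] := rtermD rterm1 (ex_intro _ s Hs).
by exists r => R e; rewrite -Hr mulrS.
Qed.

Lemma rterm_sum I (r : seq I) (F : I -> forall R : nzRingType, (V -> R) -> R) :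
  (forall i, rterm (F i)) -> rterm (fun R e => \sum_(i <- r) F i R e).
Proof.
move=> dF; apply: (@term_definable_big ring_language V I r
  (fun R => @GRing.add R) (fun R => 0) F) => //; [exact: rterm0 | exact: rtermD].
Qed.

End RingTerms.

(** Definability of a concrete term or formula follows its syntax. *)
Ltac define_term := intros; first
  [ apply: gterm1 | apply: rterm0 | apply: rterm1
  | apply: gtermV; define_term
  | apply: gtermX; define_term
  | apply: gtermM; define_term
  | apply: gterm_prod; define_term
  | apply: rterm_nat
  | apply: rtermD; define_term
  | apply: rtermM; define_term
  | apply: rterm_sum; define_term
  | apply: gterm_var | apply: rterm_var ].

Ltac define_formula := intros; first
  [ apply: definable_and; define_formula
  | apply: definable_or; define_formula
  | apply: definable_not; define_formula
  | apply: definable_cond; define_formula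
  | apply: definable_eq; define_term
  | apply: definable_imp; define_formula
  | apply: definable_all; define_formula
  | apply: definable_forall_fin; define_formula
  | apply: definable_exists_fin; define_formula
  | apply: definable_forall; define_formula
  | apply: definable_exists; define_formula ].


Section Products.
Local Open Scope group_scope.

(** A property of pairs of tuples, one in each factor of a product of groups, is
    rectangular when it is a finite union of products of definable properties of the
    factors.  These properties are closed under the logical connectives and under
    quantification over both factors, so all formulas over a product are
    rectangular: this is the theorem of Feferman and Vaught for two factors. *)
Definition rectangular V
    (P : forall G H : groupType, (V -> G) -> (V -> H) -> Prop) :=
  exists (I : finType) (a b : I -> forall G : groupType, (V -> G) -> Prop),
    (forall i, gdefinable (a i) /\ gdefinable (b i)) /\
    forall (G H : groupType) (e : V -> G) (e' : V -> H),
      P G H e e' <-> exists i, a i G e /\ b i H e'.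

Lemma rectangular_ext V (P Q : forall G H : groupType, (V -> G) -> (V -> H) -> Prop) :
  rectangular P -> (forall G H e e', Q G H e e' <-> P G H e e') -> rectangular Q.
Proof.
case=> I [a [b [dab HP]]] PQ; exists I, a, b; split=> // G H e e'.
by rewrite PQ HP.
Qed.

(** The pair avoids each rectangle a_i x b_i in its first or in its second factor;
    the union is over the set of indices for which it is the first. *)
Lemma rectangular_not V (P : forall G H : groupType, (V -> G) -> (V -> H) -> Prop) :
  rectangular P -> rectangular (fun G H e e' => ~ P G H e e').
Proof.
case=> I [a [b [dab HP]]].
exists {set I}, (fun (J : {set I}) G e => forall i, i \in J -> ~ a i G e),
  (fun (J : {set I}) G e => forall i, i \notin J -> ~ b i G e); split.
  move=> J; split; apply: definable_all => i; apply: definable_cond;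
    apply: definable_not; by case: (dab i).
move=> G H e e'; rewrite HP; split=> [nP|[J [HJ HJ']] [i [ai bi]]].
  exists [set i | ~~ `[< a i G e >]]; split=> i; rewrite inE ?negbK => /asboolP //.
  by move=> ai bi; apply: nP; exists i.
by case: (boolP (i \in J)) => [/HJ|/HJ'].
Qed.

Lemma rectangular_and V (P Q : forall G H : groupType, (V -> G) -> (V -> H) -> Prop) :
  rectangular P -> rectangular Q ->
  rectangular (fun G H e e' => P G H e e' /\ Q G H e e').
Proof.
case=> I [a [b [dab HP]]] [J [c [d [dcd HQ]]]].
exists (I * J)%type, (fun ij G e => a ij.1 G e /\ c ij.2 G e),
  (fun ij G e => b ij.1 G e /\ d ij.2 G e); split.
  move=> [i j]; case: (dab i) (dcd j) => ? ? [? ?].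
  by split; apply: definable_and.
move=> G H e e'; rewrite HP HQ; split=> [[[i [? ?]] [j [? ?]]]|].
  by exists (i, j).
by move=> [[i j] [[? ?] [? ?]]]; split; [exists i | exists j].
Qed.

(** A pair of witnesses in a rectangle is a witness in each of its sides. *)
Lemma rectangular_exists V
    (P : forall G H : groupType, (option V -> G) -> (option V -> H) -> Prop) :
  rectangular P ->
  rectangular (fun G H e e' => exists x, P G H (oapp e x.1) (oapp e' x.2)).
Proof.
case=> I [a [b [dab HP]]].
have oE T (f : option V -> T) : oapp (f \o some) (f None) = f.
  by apply/funext => -[].
exists I, (fun i G e => exists x, a i G (oapp e x)),
  (fun i G e => exists x, b i G (oapp e x)); split.
  move=> i; case: (dab i) => da db; split; apply: definable_exists.
    by apply: (definable_ext da) => G e; rewrite oE.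
  by apply: (definable_ext db) => G e; rewrite oE.
move=> G H e e'; split=> [[x /HP [i [ai bi]]]|[i [[x ax] [y bx]]]].
  by exists i; split; [exists x.1 | exists x.2].
by exists (x, y); apply/HP; exists i.
Qed.

Lemma group_eval_pair (G H : groupType) V (e : V -> G * H) (t : group_term V) :
  group_eval e t = (group_eval (fst \o e) t, group_eval (snd \o e) t).
Proof. by elim: t => /= [v||t ->|t -> u ->] //; case: (e v). Qed.

Lemma rectangular_formula V (f : formula group_term V) :
  rectangular (fun G H e e' =>
    holds (@group_eval (G * H)%type) (fun v => (e v, e' v)) f).
Proof.
have oE V' (G H : groupType) (e : V' -> G) (e' : V' -> H) x :
    oapp (fun v => (e v, e' v)) x = (fun v => (oapp e x.1 v, oapp e' x.2 v)).
  by apply/funext => -[] //=; case: x.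
elim: f => {V} [V t u|V f IH|V f IHf g IHg|V f IHf g IHg|V f IHf g IHg
               |V f IH|V f IH] /=.
- pose P (G : groupType) (e : V -> G) := group_eval e t = group_eval e u.
  exists unit, (fun _ => P), (fun _ => P); split.
    by move=> _; split; exists (FEq t u).
  move=> G H e e'; rewrite !group_eval_pair /P.
  by split=> [[tu tu']|[_ [/= tu tu']]]; [exists tt | congr (_, _)].
- exact: rectangular_not.
- exact: rectangular_and.
- have := rectangular_not (rectangular_and (rectangular_not IHf) (rectangular_not IHg)).
  move/rectangular_ext; apply=> G H e e'.
  by rewrite not_andE !notK.
- have := rectangular_not (rectangular_and IHf (rectangular_not IHg)).
  move/rectangular_ext; apply=> G H e e'; rewrite not_andE notK.
  split=> [fg|]; last by case.
  by have [/fg|] := pselect (holds (@group_eval (G * H)%type) (fun v => (e v, e' v)) f);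
    [right|left].
- have := rectangular_not (rectangular_exists (rectangular_not IH)).
  move/rectangular_ext; apply=> G H e e'.
  split=> [H1 [x]|H1 x]; first by apply; rewrite -oE; apply: H1.
  by apply: contrapT => H2; apply: H1; exists x; rewrite -oE.
apply: (rectangular_ext (rectangular_exists IH)) => G H e e'.
by split=> -[x Hx]; exists x; move: Hx; rewrite oE.
Qed.

Lemma group_elem_equiv_prod (G G' H H' : groupType) :
  group_elem_equiv G G' -> group_elem_equiv H H' ->
  group_elem_equiv (G * H)%type (G' * H')%type.
Proof.
move=> EG EH f; have [I [a [b [dab Hf]]]] := rectangular_formula f.
have vE (K K' : groupType) : models (@group_eval (K * K')%type) f <->
    exists i, a i K (of_void K) /\ b i K' (of_void K').
  rewrite -Hf; suff -> : (fun v => (of_void K v, of_void K' v)) = of_void _ by [].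
  by apply/funext.
have dE (K K' : groupType) (P : forall G : groupType, (void -> G) -> Prop) :
    gdefinable P -> group_elem_equiv K K' ->
    P K (of_void K) -> P K' (of_void K').
  by move=> [g Hg] E; rewrite (Hg K) (Hg K') => /E.
have EG' : group_elem_equiv G' G by move=> g; split=> /EG.
have EH' : group_elem_equiv H' H by move=> g; split=> /EH.
by rewrite !vE; split=> -[i [ai bi]]; exists i; have [da db] := dab i; split;
  [apply: dE ai|apply: dE bi|apply: dE ai|apply: dE bi].
Qed.

End Products.

Section Embedding.
Local Open Scope group_scope.
Variable Q : forall G : groupType, G -> Prop.

Definition embedded_onto (M N : groupType) (phi : M -> N) :=
  [/\ {morph phi : x y / x * y}, injective phi & forall y, Q y <-> exists x, y = phi x].

Hypothesis Q_definable : gdefinable (fun G (e : unit -> G) => Q (e tt)).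

Lemma embedded_onto_interp (f : formula group_term void) :
  exists D : groupType -> Prop, gdefinable (fun G (e : void -> G) => D G) /\
    forall (M N : groupType) (phi : M -> N), embedded_onto phi ->
      D N <-> models (@group_eval M) f.
Proof.
pose Rel (N : groupType) (p : void -> N) (M : groupType) (C : M -> unit -> N) :=
  embedded_onto (fun m => C m tt).
have [|||D [dD HD]] := @sentence_interp group_language group_language void unit Rel
  (fun N p x => Q (x tt)) _ _ _ f.
- exact: (definable_ext (definable_map (fun v : unit => inr v) Q_definable)).
- move=> N p M C [_ _ CQ] x; rewrite CQ; split=> -[m xm]; exists m; last by rewrite xm.
  by apply/funext => -[].
- move=> V t.
  exists (fun N p x y => group_eval (fun v => x (v, tt)) t = y tt); split.
    have [s Hs] : gterm (fun (N : groupType) (e : void + (V * unit + unit) -> N) =>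
        group_eval (fun v => e (inr (inl (v, tt)))) t).
      elim: t => [v||t IH|t IHt u IHu] /=; try define_term.
      - exact: gtermV.
      - exact: gtermM.
    apply: definable_eq; first by exists s.
    exact: gterm_var.
  move=> N p M C [CM Cinj _] e m.
  have C1 : C 1 tt = 1 by apply: (@mulgI _ (C 1 tt)); rewrite -CM !mulg1.
  have CV x : C x^-1 tt = (C x tt)^-1.
    by apply: (@mulgI _ (C x tt)); rewrite -CM !mulgV.
  suff -> : group_eval (fun v => coords e C (v, tt)) t = C (group_eval e t) tt.
    by split=> [/Cinj|<-].
  by elim: t => /= [v||t ->|t -> u ->].
exists (fun N => D N (of_void N)); split.
  by apply: (definable_ext dD) => N e; suff -> : of_void N = e by []; apply/funext.
by move=> M N phi Hphi; apply: (HD N (of_void N) M (fun m _ => phi m)).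
Qed.

(** Used for the centers, which are definable subgroups, and for isomorphisms, with
    the trivial property for [Q]. *)
Lemma embedded_onto_elem_equiv (M M' N N' : groupType) (phi : M -> N) (phi' : M' -> N') :
  embedded_onto phi -> embedded_onto phi' ->
  group_elem_equiv N N' -> group_elem_equiv M M'.
Proof.
move=> Hphi Hphi' E f; have [D [dD HD]] := embedded_onto_interp f.
rewrite -(HD _ _ _ Hphi) -(HD _ _ _ Hphi').
exact: (@elem_equiv_transfer group_language _ _ D E dD).
Qed.

End Embedding.

Lemma group_iso_elem_equiv (G H : groupType) : group_iso G H -> group_elem_equiv G H.
Proof.
move=> [f bf].
apply: (@embedded_onto_elem_equiv (fun _ _ => True) _ G H H H f id) => //.
- exact: (@definable_true group_language).
- have [g fK gK] := bf.
  by split=> [x y||y]; [exact: gmulfM|exact: bij_inj|split=> // _; exists (g y)].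
- by split=> // y; split=> // _; exists y.
Qed.

(** * Triangular matrices modulo scalars *)

Section Triangular.
Local Open Scope ring_scope.
Variables (F : fieldType) (n : nat).
Local Notation T := (tri_group F n.+1).
Implicit Types (A B : T) (i j k : 'I_n.+1).

Lemma upper_triangular_unitmx (A : 'M[F]_n.+1) : upper_triangular A ->
  (forall i, A i i != 0) -> A \in unitmx.
Proof.
move=> /upper_triangularP tA nzA; rewrite unitmxE unitfE -det_tr.
rewrite det_trig; last by apply/is_trig_mxP => i j ij; rewrite mxE tA.
by apply/prodf_neq0 => i _; rewrite mxE.
Qed.

Lemma tri_lower A i j : (j < i)%N -> val A i j = 0.
Proof. by move=> ij; have /andP[/upper_triangularP->] := valP A. Qed.

Lemma tri_diag_neq0 A i : val A i i != 0.
Proof.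
have /andP[/upper_triangularP tA] := valP A.
rewrite unitmxE unitfE -det_tr det_trig; last first.
  by apply/is_trig_mxP => k j kj; rewrite mxE tA.
by move=> /prodf_neq0 /(_ i isT); rewrite mxE.
Qed.

Lemma triM A B i j : val (A * B)%g i j = \sum_k val A i k * val B k j.
Proof. by rewrite mxE. Qed.

Lemma tri_diagM A B i : val (A * B)%g i i = val A i i * val B i i.
Proof.
rewrite triM (bigD1 i) //= big1 ?addr0 // => k nki.
by case: (ltngtP k i) nki => [ki|ik|/val_inj ->]; rewrite ?eqxx //
  ?(tri_lower A ki) ?(tri_lower B ik) ?mul0r ?mulr0.
Qed.

Lemma tri_diag1 i : val (1%g : T) i i = 1.
Proof. by rewrite mxE eqxx. Qed.

Lemma tri_diagV A i : val (A^-1)%g i i = (val A i i)^-1.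
Proof.
apply: (mulfI (tri_diag_neq0 A i)).
by rewrite -tri_diagM mulgV tri_diag1 mulfV // tri_diag_neq0.
Qed.

Lemma tri_diagR A B i : val [~ A, B]%g i i = 1.
Proof.
rewrite /commg /conjg !tri_diagM !tri_diagV.
by rewrite [X in _ * (_ * X)]mulrC mulKf ?mulVf ?tri_diag_neq0.
Qed.

Definition tri_of (A : 'M[F]_n.+1) (tA : upper_triangular A)
    (dA : forall i, A i i != 0) : T :=
  TriGroup (introT andP (conj tA (upper_triangular_unitmx tA dA))).

Lemma exists_tri (A : 'M[F]_n.+1) : (forall i j, (j < i)%N -> A i j = 0) ->
  (forall i, A i i != 0) -> exists B : T, val B = A.
Proof. by move=> /upper_triangularP tA dA; exists (tri_of tA dA). Qed.

Lemma exists_elementary i j (a : F) : (i <= j)%N -> (i == j -> 1 + a != 0) ->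
  exists B : T, val B = 1%:M + a *: delta_mx i j.
Proof.
move=> ij nza; apply: exists_tri => [k l lk|k]; rewrite !mxE.
  have /negPf -> : k != l by rewrite -val_eqE gtn_eqF.
  case: andP => [[/eqP Ek /eqP El]|_]; last by rewrite mulr0 addr0.
  by move: lk; rewrite Ek El ltnNge ij.
rewrite eqxx; case: andP => [[/eqP -> /eqP]|_].
  by rewrite mulr1 => Eij; apply: nza; rewrite Eij.
by rewrite mulr0 addr0 oner_neq0.
Qed.

Lemma exists_scalar (a : F) : a != 0 -> exists B : T, val B = a%:M.
Proof.
move=> nza; apply: exists_tri => [i j ji|i]; rewrite !mxE.
  by case: eqVneq ji => // ->; rewrite ltnn.
by rewrite eqxx.
Qed.

(** The first basis vector is an eigenvector of every upper triangular matrix. *)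
Lemma mul_col0 A j : val A *m delta_mx 0 j = val A 0 0 *: delta_mx 0 j.
Proof.
apply/matrixP => i k; rewrite !mxE (bigD1 0) //= big1 ?addr0; last first.
  by move=> l nl; rewrite mxE (negPf nl) mulr0.
rewrite mxE eqxx /=; have [->|ni] := eqVneq i 0; first by [].
by rewrite tri_lower ?mul0r ?mulr0 // lt0n.
Qed.

Hypothesis two_neq0 : 2%:R != 0 :> F.

(** Commuting with 1 + e_1i forces row i of A to be A_11 times that of the identity.
    In characteristic 2 the matrix 1 + e_11 is singular, and over the field with two
    elements the center is larger. *)
Lemma centralE A : (A \in @central T) = (val A == (val A 0 0)%:M).
Proof.
apply/centralP/eqP => [cA|E B]; last first.
  by apply: val_inj; rewrite [LHS]/= [RHS]/= E scalar_mxC.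
apply/matrixP => i j.
have [X EX] := @exists_elementary 0 i 1 (leq0n i) (fun _ => two_neq0).
have := congr1 val (cA X); rewrite [LHS]/= [RHS]/= EX mulmxDl mulmxDr mul1mx mulmx1.
move/addrI; rewrite scale1r mul_col0 => /matrixP/(_ 0 j).
rewrite !mxE eqxx (bigD1 i) //= big1 ?addr0; last first.
  by move=> l nl; rewrite mxE (negPf nl) andbF mul0r.
by rewrite mxE !eqxx mul1r => <-; rewrite eq_sym; case: eqP => _; rewrite ?mulr1 ?mulr0.
Qed.

(** The entries of the only matrix with upper left entry 1 in the class of [A]
    modulo scalars. *)
Definition nmx A (ij : 'I_n.+1 * 'I_n.+1) : F := val A ij.1 ij.2 / val A 0 0.

Definition normalized (x : 'I_n.+1 * 'I_n.+1 -> F) :=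
  [/\ forall i j, (j < i)%N -> x (i, j) = 0, x (0, 0) = 1
    & forall i, x (i, i) != 0].

Lemma nmx_normalized A : normalized (nmx A).
Proof.
split=> [i j ij||i]; rewrite /nmx /=.
- by rewrite tri_lower ?mul0r.
- by rewrite mulfV ?tri_diag_neq0.
by rewrite mulf_neq0 ?invr_eq0 ?tri_diag_neq0.
Qed.

Lemma normalized_nmx x : normalized x -> exists A, x = nmx A.
Proof.
move=> [x0 x1 dx].
have [||A EA] := @exists_tri (\matrix_(i, j) x (i, j)).
- by move=> i j ji; rewrite mxE x0.
- by move=> i; rewrite mxE dx.
exists A; apply/funext => -[i j]; rewrite /nmx EA !mxE /= x1.
by rewrite divr1.
Qed.

Lemma nmx1 i j : nmx 1%g (i, j) = (i == j)%:R.
Proof. by rewrite /nmx /= !mxE eqxx divr1. Qed.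

Lemma nmxM A B i j : nmx (A * B)%g (i, j) = \sum_k nmx A (i, k) * nmx B (k, j).
Proof.
rewrite /nmx /= tri_diagM triM mulr_suml; apply: eq_bigr => k _.
by rewrite mulf_div.
Qed.

Lemma nmx_central A : (forall i j, nmx A (i, j) = (i == j)%:R) <-> A \in @central T.
Proof.
rewrite centralE; split=> [H|/eqP E i j].
  apply/eqP/matrixP => i j; rewrite mxE -[LHS](divfK (tri_diag_neq0 A 0)).
  by have := H i j; rewrite /nmx /= => ->; rewrite mulrC mulr_natr.
rewrite /nmx {1}E /= mxE; case: eqP => _; last by rewrite mul0r.
by rewrite mulfV ?tri_diag_neq0.
Qed.

Lemma nmx_same_coset A B : nmx A = nmx B <-> same_coset A B.
Proof.
split=> [E|].
  apply/nmx_central => i j; rewrite nmxM -E -nmxM mulVg.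
  exact: nmx1.
move=> /nmx_central H; apply/funext => -[i j].
rewrite -[in RHS](mulVKg A B) nmxM (bigD1 j) //= H eqxx mulr1 big1 ?addr0 // => k nkj.
by rewrite H (negPf nkj) mulr0.
Qed.

End Triangular.

Lemma group_iso_of_morph (G H : groupType) (f : G -> H) :
  {morph f : x y / (x * y)%g} -> injective f -> (forall y, exists x, f x = y) ->
  group_iso G H.
Proof.
move=> fM finj fonto.
pose fm : {multiplicative G -> H} := HB.pack f (isMultiplicative.Build G H f fM).
have [g gK] := choice fonto; exists fm; exists g => // x.
by apply: finj; rewrite gK.
Qed.

Section ProjectiveTriangular.
Local Open Scope ring_scope.
Variables (F : fieldType) (n : nat).
Local Notation T := (tri_group F n.+1).
Local Notation PT := (center_quotient T).
Hypothesis two_neq0 : 2%:R != 0 :> F.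

Definition qpi (A : T) : PT := (\pi_(PT) A)%qT.

Lemma qpiP (A B : T) : reflect (qpi A = qpi B) (same_coset A B).
Proof. exact: pi_eqP. Qed.

Lemma qpiM (A B : T) : qpi (A * B)%g = (qpi A * qpi B)%g.
Proof. by rewrite /qpi [RHS]quot_mulE. Qed.

Lemma qpi_onto (q : PT) : exists A, q = qpi A.
Proof. by exists (repr q); rewrite /qpi reprK. Qed.

Definition pnmx (q : PT) := nmx (repr q).

Lemma pnmx_qpi A : pnmx (qpi A) = nmx A.
Proof. by apply/(nmx_same_coset two_neq0); apply: same_coset_repr. Qed.

(** The upper left entry is a character of the group which restricts to an
    isomorphism on the center. *)
Lemma tri_group_splits :
  group_iso T (PT * mul_group F)%type.
Proof.
pose f (A : T) : (PT * mul_group F)%type := (qpi A, MulGroup (tri_diag_neq0 A 0)).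
have fM : {morph f : A B / (A * B)%g}.
  move=> A B; congr (_, _); first exact: qpiM.
  by apply: val_inj; rewrite /= -tri_diagM.
apply: (group_iso_of_morph fM) => [A B [/qpiP AB AB0]|[q z]].
  have := nmx_same_coset two_neq0 A B; case=> _ /(_ AB) E.
  apply: val_inj; apply/matrixP => i j.
  have := congr1 (fun x => x (i, j)) E.
  by rewrite /nmx /= AB0; apply: divIf; apply: tri_diag_neq0.
have [A ->] := qpi_onto q.
have nzc : val z / val A 0 0 != 0.
  by rewrite mulf_neq0 ?(valP z) ?invr_eq0 ?tri_diag_neq0.
have [B EB] := @exists_scalar F n _ nzc.
have cB : B \in @central T by rewrite centralE // EB !mxE eqxx.
exists (A * B)%g; congr (_, _).
  by apply/qpiP; rewrite same_coset_sym /same_coset mulKg.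
by apply: val_inj; rewrite /= tri_diagM EB mxE eqxx mulrC divfK ?tri_diag_neq0.
Qed.

Lemma pnmx_inj : injective pnmx.
Proof.
move=> p q; have [A ->] := qpi_onto p; have [B ->] := qpi_onto q.
by rewrite !pnmx_qpi => /(nmx_same_coset two_neq0) AB; apply/qpiP.
Qed.

Lemma pnmx1 i j : pnmx 1%g (i, j) = (i == j)%:R.
Proof. by rewrite -[1%g]/(qpi 1%g) pnmx_qpi nmx1. Qed.

Lemma pnmxM p q i j : pnmx (p * q)%g (i, j) = \sum_k pnmx p (i, k) * pnmx q (k, j).
Proof.
have [A ->] := qpi_onto p; have [B ->] := qpi_onto q.
by rewrite -qpiM !pnmx_qpi nmxM.
Qed.

Lemma pnmx_normalized q : normalized (pnmx q).
Proof. by have [A ->] := qpi_onto q; rewrite pnmx_qpi; apply: nmx_normalized. Qed.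

Lemma normalized_pnmx x : normalized x -> exists q, x = pnmx q.
Proof. by move=> /normalized_nmx [A ->]; exists (qpi A); rewrite pnmx_qpi. Qed.

End ProjectiveTriangular.

Section InterpretPT.
Local Open Scope ring_scope.
Variable n : nat.
Local Notation I := ('I_n.+1 * 'I_n.+1)%type.

Definition triangular_dom (R : nzRingType) (x : I -> R) :=
  (forall i j : 'I_n.+1, (j < i)%N -> x (i, j) = 0) /\
  x (0, 0) = 1 /\ forall i, x (i, i) <> 0.

(** What a group must share with PT_n(R) for the matrix entries to interpret it
    in R. *)
Definition triangular_coords (R : nzRingType) (p : void -> R) (M : groupType)
    (C : M -> I -> R) :=
  [/\ forall i j, C 1%g (i, j) = (i == j)%:R,
      forall x y i j, C (x * y)%g (i, j) = \sum_k C x (i, k) * C y (k, j),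
      injective C
    & forall x, triangular_dom x <-> exists m, x = C m].

(** The graph of each group operation is given by the corresponding equations
    between matrices.  For the inverse, y = z^-1 is stated as y z = 1. *)
Lemma triangular_coords_interp (f : formula group_term void) :
  exists D : nzRingType -> Prop, rdefinable (fun R (e : void -> R) => D R) /\
    forall (R : nzRingType) p (M : groupType) C, @triangular_coords R p M C ->
      D R <-> models (@group_eval M) f.
Proof.
have [|||D [dD HD]] := @sentence_interp ring_language group_language void I
  triangular_coords (fun R p x => triangular_dom x) _ _ _ f.
- by unfold triangular_dom; define_formula.
- by move=> R p M C [_ _ _ CP] x; apply: CP.
- move=> V; elim=> [v||t [D [dD HD]]|t [D [dD HD]] u [E [dE HE]]].
  + exists (fun N p x y => forall i, y i = x (v, i)); split; first define_formula.
    move=> N p M C [_ _ Cinj _] e m; rewrite /coords /=.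
    by split=> [H|<-] //; apply: Cinj; apply/funext => i; rewrite H.
  + exists (fun N p x y => forall i j, y (i, j) = (i == j)%:R); split.
      define_formula.
    move=> N p M C [C1 _ Cinj _] e m /=.
    split=> [H|<-] //; apply: Cinj; apply/funext => -[i j].
    by rewrite H.
  + exists (fun (N : nzRingType) p x y => exists z : I -> N,
       triangular_dom z /\ D N p x z /\
       forall i j, \sum_k y (i, k) * z (k, j) = (i == j)%:R); split.
      pose s (v : void + (V * I + I)) : (void + (V * I + I)) + I :=
        match v with inl w => inl (inl w) | inr (inl w) => inl (inr (inl w))
        | inr (inr i) => inr i end.
      apply: definable_exists_fin; apply: definable_and.
        by unfold triangular_dom; define_formula.
      apply: definable_and; last define_formula.
      exact: (definable_ext (definable_map s dD)).
    move=> N p M C R e m; have [C1 CM Cinj CP] := R.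
    split=> [[z [/CP [y ->] [/(HD _ _ _ _ R) Dy yz]]]|/= <-].
      apply: (@mulIg _ (value e t)); rewrite mulVg Dy; apply: Cinj.
      by apply/funext => -[i j]; rewrite CM yz C1.
    exists (C (value e t)); split; first by apply/CP; eexists.
    split; first exact/(HD _ _ _ _ R).
    by move=> i j; rewrite -CM mulVg C1.
  exists (fun (N : nzRingType) p x y => exists z : I -> N, exists w : I -> N,
     triangular_dom z /\ triangular_dom w /\ D N p x z /\ E N p x w /\
     forall i j, y (i, j) = \sum_k z (i, k) * w (k, j)); split.
    pose s (v : void + (V * I + I)) : ((void + (V * I + I)) + I) + I :=
      match v with inl w => inl (inl (inl w)) | inr (inl w) => inl (inl (inr (inl w)))
      | inr (inr i) => inl (inr i) end.
    pose s' (v : void + (V * I + I)) : ((void + (V * I + I)) + I) + I :=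
      match v with inl w => inl (inl (inl w)) | inr (inl w) => inl (inl (inr (inl w)))
      | inr (inr i) => inr i end.
    apply: definable_exists_fin; apply: definable_exists_fin.
    apply: definable_and; first by unfold triangular_dom; define_formula.
    apply: definable_and; first by unfold triangular_dom; define_formula.
    apply: definable_and; first exact: (definable_ext (definable_map s dD)).
    apply: definable_and; first exact: (definable_ext (definable_map s' dE)).
    define_formula.
  move=> N p M C R e m; have [C1 CM Cinj CP] := R.
  split=> [[z [w [/CP [y ->] [/CP [y' ->]]]]]|/= <-].
    case=> /(HD _ _ _ _ R) Dy [/(HE _ _ _ _ R) Ey yz].
    transitivity ((y : M) * (y' : M))%g; first exact: congr2 Dy Ey.
    by apply: Cinj; apply/funext => -[i j]; rewrite CM yz.
  exists (C (value e t)), (C (value e u)).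
  split; first by apply/CP; eexists.
  split; first by apply/CP; eexists.
  split; first exact/(HD _ _ _ _ R).
  split; first exact/(HE _ _ _ _ R).
  by move=> i j; rewrite -CM.
exists (fun R => D R (of_void R)); split.
  by apply: (definable_ext dD) => R e; suff -> : of_void R = e by []; apply/funext.
by move=> R p M C RC; rewrite (_ : of_void R = p) ?(HD _ _ _ _ RC) //; apply/funext.
Qed.

Lemma pnmx_triangular_coords (F : fieldType) p : 2%:R != 0 :> F ->
  @triangular_coords F p (center_quotient (tri_group F n.+1)) (@pnmx F n).
Proof.
move=> two_neq0; split.
- exact: pnmx1.
- exact: pnmxM.
- exact: pnmx_inj.
move=> x; split=> [[x0 [x1 dx]]|[q ->]].
  by apply: normalized_pnmx => //; split=> // i; apply/eqP/dx.
by have [x0 x1 dx] := pnmx_normalized two_neq0 q; split=> //; split=> // i; apply/eqP.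
Qed.

Lemma projective_tri_elem_equiv (F L : fieldType) :
  2%:R != 0 :> F -> 2%:R != 0 :> L -> ring_elem_equiv L F ->
  group_elem_equiv (center_quotient (tri_group L n.+1))
                   (center_quotient (tri_group F n.+1)).
Proof.
move=> two_F two_L E f; have [D [dD HD]] := triangular_coords_interp f.
rewrite -(HD F _ _ _ (pnmx_triangular_coords (of_void F) two_F)).
rewrite -(HD L _ _ _ (pnmx_triangular_coords (of_void L) two_L)).
exact: (@elem_equiv_transfer ring_language _ _ D E dD).
Qed.

End InterpretPT.

Lemma ring_elem_equiv_two (F L : nzRingType) : ring_elem_equiv L F ->
  (2%:R != 0 :> F)%R -> (2%:R != 0 :> L)%R.
Proof.
move=> E; have d : rdefinable (fun (R : nzRingType) (e : void -> R) => 2%:R = 0 :> R)%R.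
  by unfold rdefinable; define_formula.
by apply: contra_neq => /(@elem_equiv_transfer ring_language L F
  (fun R : nzRingType => 2%:R = 0 :> R)%R E d).
Qed.

(** T_n(F) and H are both products of a projective triangular group and an abelian
    group, and the factors are elementarily equivalent in pairs. *)
Lemma equiv_of_iso (n : nat) (F L : fieldType) (H : groupType) :
  (2%:R != 0 :> F)%R -> ring_elem_equiv L F ->
  group_iso H (center_quotient (tri_group L n.+1) * center H)%type ->
  group_elem_equiv (center H) (mul_group F) ->
  group_elem_equiv (tri_group F n.+1) H.
Proof.
move=> two_F E iH EZ f.
have two_L := ring_elem_equiv_two E two_F.
have i1 := group_iso_elem_equiv (tri_group_splits n two_F) f.
have i2 := group_iso_elem_equiv iH f.
have i3 := group_elem_equiv_prod (projective_tri_elem_equiv n two_F two_L E) EZ f.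
by rewrite i1 i2; split=> /i3.
Qed.

(** * Retractions onto central subgroups *)

Section Retractions.
Local Open Scope group_scope.
Variable G : groupType.
Implicit Types (M N P B : G -> Prop) (x y z g h : G).

Definition subgroup M :=
  [/\ M 1, forall x y, M x -> M y -> M (x * y) & forall x, M x -> M x^-1].

(** The subgroup generated by the values of [f], when these are closed under
    inverses.  A product of a fixed number of values is given by a term, which is what
    makes statements on this subgroup transfer between elementarily equivalent
    groups. *)
Definition products (T : Type) (f : T -> G) x := exists s : seq T, x = \prod_(t <- s) f t.

Lemma products_subgroup (T : Type) (f : T -> G) :
  (forall t, exists t', f t' = (f t)^-1) -> subgroup (products f).
Proof.
move=> fV; split; first by exists [::]; rewrite big_nil.
  by move=> x y [s ->] [r ->]; exists (s ++ r); rewrite big_cat.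
move=> x [s ->]; elim: s => [|t s [r IH]]; first by exists [::]; rewrite !big_nil invg1.
have [t' ft'] := fV t; exists (rcons r t').
by rewrite big_cons invgM -cats1 big_cat big_seq1 ft' -IH.
Qed.

Lemma products_gen (T : Type) (f : T -> G) t : products f (f t).
Proof. by exists [:: t]; rewrite big_seq1. Qed.

Definition commutators (p : G * G) := [~ p.1, p.2].

Lemma commutators_subgroup : subgroup (products commutators).
Proof.
apply: products_subgroup => -[x y]; exists (y, x).
by rewrite /commutators invgR.
Qed.

Definition squares x := x ^+ 2.

Lemma squares_subgroup : subgroup (products squares).
Proof. by apply: products_subgroup => x; exists x^-1; rewrite /squares expVgn. Qed.

(** [x, y] = (x^-1)^2 (x y^-1)^2 y^2. *)
Lemma commutator_squares x y : products squares [~ x, y].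
Proof.
exists [:: x^-1; x * y^-1; y]; rewrite !big_cons big_nil mulg1 /squares !expg2.
by rewrite /commg /conjg !mulgA mulgVK mulgVK.
Qed.

(** Modulo a subgroup that contains all commutators, factors commute. *)
Section Abelian.
Variable M : G -> Prop.
Hypotheses (sM : subgroup M) (RM : forall x y, M [~ x, y]).

Lemma subgroup_mulr x y : M y -> M (x * y) <-> M x.
Proof.
have [_ MM MV] := sM; move=> My; split=> Mx; last exact: MM.
by rewrite -(mulgK y x); apply: MM => //; apply: MV.
Qed.

Lemma subgroup_swap x y z t : M (x * y * z * t) -> M (x * z * y * t).
Proof.
have [_ MM MV] := sM => Mx.
have -> : x * z * y * t = x * y * z * t * [~ z, y] ^ t.
  by rewrite /commg /conjg !mulgA mulgK mulgK mulgK.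
apply/subgroup_mulr => //.
by rewrite conjRg; apply: RM.
Qed.

End Abelian.

(** Zorn's lemma, among the subgroups that contain [N] and avoid [B].  As [N] contains
    the commutators, the subgroup generated by a maximal [M] and an element g is
    M <g>; when g is not in [M], this subgroup meets [B].  A power of g in <g> is
    written g^i g^-j with natural exponents. *)
Lemma maximal_subgroup N B :
  subgroup N -> (forall x y, N [~ x, y]) -> (forall x, N x -> ~ B x) ->
  exists M, [/\ subgroup M, forall x, N x -> M x, forall x, M x -> ~ B x
    & forall g, ~ M g -> exists b i j, B b /\ M (b * (g ^+ i * g ^- j))].
Proof.
move=> sN RN NB.
(* The empty set counts as good, since the union of the empty chain is empty. *)
pose good M := [/\ subgroup M, forall x, N x -> M x & forall x, M x -> ~ B x].
have [|M [goodM maxM]] := @Zorn_bigcup G [set M | M = set0 \/ good M]%classic.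
  move=> S SP tot.
  have [[A [SA [a Aa]]]|noA] := pselect (exists A, S A /\ exists a, A a); last first.
    left; apply/seteqP; split=> // x [A SA Ax].
    by apply: noA; exists A; split=> //; exists x.
  have goodS A' x : S A' -> A' x -> good A'.
    by move=> /SP [->|].
  have [[A1 _ _] NA _] := goodS _ _ SA Aa.
  right; split.
  - split; first by exists A.
    + move=> x y [X SX Xx] [Y SY Yy].
      have [[_ XM _] _ _] := goodS _ _ SX Xx; have [[_ YM _] _ _] := goodS _ _ SY Yy.
      have [XY|YX] := tot _ _ SX SY.
        by exists Y => //; apply: YM => //; apply: XY.
      by exists X => //; apply: XM => //; apply: YX.
    + move=> x [X SX Xx]; have [[_ _ XV] _ _] := goodS _ _ SX Xx.
      by exists X => //; apply: XV.
  - by move=> x Nx; exists A => //; apply: NA.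
  - by move=> x [X SX Xx]; have [_ _] := goodS _ _ SX Xx; apply.
have {}goodM : good M.
  have goodN : good N by split.
  case: goodM => // M0; exfalso; apply: (maxM N); last by right.
  rewrite M0; split=> [x|] //; move=> /(_ 1); apply.
  by case: sN.
have [[M1 MM MV] NM MB] := goodM; have sM : subgroup M by split.
exists M; split=> // g nMg; apply: contrapT => noB.
have RM x y : M [~ x, y] by apply: NM.
pose M' x := exists i j, M (x * (g ^+ i * g ^- j)).
have MM' x : M x -> M' x by exists 0, 0; rewrite expg0 invg1 !mulg1.
apply: (maxM M').
  split; first exact: MM'.
  move=> /(_ g) H; apply: nMg; apply: H; exists 0, 1%N.
  by rewrite expg0 mul1g expg1 mulgV.
right; split.
- split; first exact: MM'.
  + move=> x y [i [j Mx]] [k [l My]]; exists (i + k)%N, (j + l)%N.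
    have -> : g ^+ (i + k) * g ^- (j + l) = (g ^+ i * g ^- j) * (g ^+ k * g ^- l).
      have c : commute (g ^+ k * g ^- l) (g ^- j).
        apply/commuteV/commute_sym/commuteM; last apply/commuteV; exact: commuteX2.
      by rewrite !expgnDr invgM -!mulgA -c !mulgA.
    by rewrite mulgA; apply: subgroup_swap => //; rewrite -mulgA; apply: MM.
  + move=> x [i [j Mx]]; exists j, i.
    have -> : x^-1 * (g ^+ j * g ^- i) = 1 * x^-1 * (g ^+ i * g ^- j)^-1 * 1.
      by rewrite mul1g mulg1 invgF.
    by apply: subgroup_swap => //; rewrite mul1g mulg1 -invgM; apply: MV.
- by move=> x /NM /MM'.
- by move=> x [i [j Mx]] Bx; apply: noB; exists x, i, j.
Qed.

Lemma subgroup_pow_diff M g i j : subgroup M ->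
  M (g ^+ i * g ^- j) <-> M (g ^+ ((i - j) + (j - i))).
Proof.
move=> [_ _ MV]; have [ij|/ltnW ji] := leqP i j.
  rewrite (eqP ij) add0n -{1}(subnK ij) expgnDr invgM mulVKg.
  by split=> /MV; rewrite ?invgK.
by rewrite (eqP ji) addn0 -{1}(subnK ji) expgnDr mulgK.
Qed.

(** Divisible abelian groups are injective.  Take M maximal among the subgroups that
    contain [N] and meet [P] trivially; the claim is M P = G.  If g is outside M P, let
    k be minimal with g^k in M P, say g^k p in M with p = r^k and r in [P].  Then
    g' = g r has g'^k in M, and k is minimal for g' too.  By maximality some
    b <> 1 of [P] has b g'^d in M, so g'^d is in M P and k divides d; hence g'^d, and
    with it b, is in M, a contradiction. *)
Lemma divisible_retraction P N :
  subgroup P -> (forall p, P p -> p \in @central G) ->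
  (forall n p, (0 < n)%N -> P p -> exists2 r, P r & r ^+ n = p) ->
  subgroup N -> (forall x y, N [~ x, y]) -> (forall x, N x -> P x -> x = 1) ->
  exists chi : G -> G, [/\ {morph chi : x y / x * y},
    forall x, P (chi x) & forall p, P p -> chi p = p].
Proof.
move=> sP cP divP sN RN NP.
have [|M [sM NM MP maxM]] := @maximal_subgroup N (fun x => P x /\ x <> 1) sN RN.
  by move=> x Nx [Px]; apply; apply: NP.
have [M1 MM MV] := sM; have [P1 PM PV] := sP.
have MP1 x : M x -> P x -> x = 1.
  by move=> /MP nB Px; apply: contrapT => nx; apply: nB.
have cPE p x : P p -> x * p = p * x by move=> /cP/centralP/(_ x) ->.
(* K is the subgroup M P. *)
pose K g := exists2 p, P p & M (g * p).
have sK : subgroup K.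
  split; first by exists 1 => //; rewrite mulg1.
    move=> x y [p Pp Mx] [q Pq My]; exists (p * q); first exact: PM.
    by rewrite -mulgA [y * _]mulgA (cPE p y) // -!mulgA mulgA; apply: MM.
  move=> x [p Pp Mx]; exists p^-1; first exact: PV.
  by rewrite -[_ * _]invgM -(cPE p) //; apply: MV.
have [K1 KM KV] := sK.
have KX x m : K x -> K (x ^+ m).
  by move=> Kx; elim: m => // m IH; rewrite expgS; apply: KM.
have PX x m : P x -> P (x ^+ m).
  by move=> Kx; elim: m => // m IH; rewrite expgS; apply: PM.
have MX x m : M x -> M (x ^+ m).
  by move=> Kx; elim: m => // m IH; rewrite expgS; apply: MM.
have step g : ~ M g -> exists i j p, [/\ P p, p <> 1, M (p * (g ^+ i * g ^- j))
    & K (g ^+ ((i - j) + (j - i)))].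
  move=> /maxM [p [i [j [[Pp np] Mp]]]]; exists i, j, p; split=> //.
  apply/(subgroup_pow_diff g i j sK); exists p => //.
  by rewrite cPE.
have allK g : K g.
  apply: contrapT => nKg.
  have exk : exists k, (0 < k)%N && `[< K (g ^+ k) >].
    have [|i [j [p [Pp np Mp Kij]]]] := step g.
      by move=> Mg; apply: nKg; exists 1 => //; rewrite mulg1.
    exists ((i - j) + (j - i))%N; apply/andP; split; last exact/asboolP.
    rewrite lt0n; apply: contra_notN np => /eqP E.
    apply: MP1 => //; have : i = j by lia.
    by move=> Eij; move: Mp; rewrite Eij mulgV mulg1.
  have [k /andP [k0 /asboolP [p Pp Mk]] mink] := ex_minnP exk.
  have [r Pr rk] := divP _ _ k0 Pp.
  have Mgr : M ((g * r) ^+ k) by rewrite expgMn ?rk //; apply: cPE.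
  have [|i [j [q [Pq nq Mq [t Pt Mt]]]]] := step (g * r).
    by move=> Mg; apply: nKg; exists r.
  set d := ((i - j) + (j - i))%N in Mt.
  have Kd : K (g ^+ d).
    exists (r ^+ d * t); first by apply: PM => //; apply: PX.
    by rewrite mulgA -expgMn //; apply: cPE.
  have Kmod : K (g ^+ (d %% k)).
    move: Kd; rewrite {1}(divn_eq d k) addnC expgnDr => Kd.
    have := KV _ (KX _ (d %/ k) (ex_intro2 _ _ p Pp Mk)).
    by rewrite -expgnA mulnC => /(KM _ _ Kd); rewrite mulgK.
  have dk : (d %% k = 0)%N.
    apply/eqP; rewrite -leqn0 leqNgt; apply/negP => dk0.
    have := mink (d %% k); rewrite dk0 /= => H.
    by have := H (introT (asboolP _) Kmod); rewrite leqNgt ltn_mod k0.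
  have /(subgroup_pow_diff (g * r) i j sM) Mij : M ((g * r) ^+ d).
    by rewrite (divn_eq d k) dk addn0 mulnC expgnA; apply: MX.
  apply: nq; apply: MP1 => //.
  by apply/(subgroup_mulr sM q Mij).
have [chi Hchi] := choice (fun g => let: ex_intro2 p Pp Mp := allK g in
  ex_intro (fun p => P p /\ M (g * p)) p (conj Pp Mp)).
have uniq_chi g p : P p -> M (g * p) -> p = chi g.
  move=> Pp Mp; have [Pc Mc] := Hchi g.
  have := MM _ _ (MV _ Mp) Mc; rewrite invgM -mulgA mulKg => Mpc.
  by apply/(mulgI p^-1); rewrite mulVg (MP1 _ Mpc) //; apply: PM => //; apply: PV.
exists (fun g => (chi g)^-1); split.
- move=> x y; have [Px Mx] := Hchi x; have [Py My] := Hchi y.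
  rewrite -invgM; congr (_^-1); rewrite -(uniq_chi (x * y) (chi x * chi y)).
  + by rewrite cPE.
  + exact: PM.
  by rewrite -mulgA [y * _]mulgA (cPE _ y) // -!mulgA mulgA; apply: MM.
- by move=> x; apply: PV; case: (Hchi x).
by move=> p Pp; rewrite -(uniq_chi p p^-1) ?invgK ?mulgV //; apply: PV.
Qed.

(** A maximal subgroup that contains all squares and avoids [e] has index 2, and [e]
    represents the other coset. *)
Lemma involution_retraction e :
  e \in @central G -> e ^+ 2 = 1 -> ~ products squares e ->
  exists chi : G -> G, [/\ {morph chi : x y / x * y},
    forall x, chi x = 1 \/ chi x = e, chi e = e & forall x, chi (x ^+ 2) = 1].
Proof.
move=> /centralP ce; rewrite expg2 => e2 ne.
have [|M [sM NM MP maxM]] := @maximal_subgroup (products squares) (fun x => x = e)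
  squares_subgroup commutator_squares.
  by move=> x + xe; rewrite xe.
have [M1 MM MV] := sM.
have nMe : ~ M e by move/MP.
have MX x m : M x -> M (x ^+ m).
  by move=> Kx; elim: m => // m IH; rewrite expgS; apply: MM.
have Msq x : M (x ^+ 2) by apply: NM; apply: products_gen.
have MeX g m : ~ M g -> M (e * g ^+ m) -> M (e * g).
  move=> nMg; rewrite -(odd_double_half m) expgnDr -muln2 mulnC expgnA mulgA.
  move=> /(subgroup_mulr sM _ (MX _ m./2 (Msq g))).
  by case: (odd m) => //; rewrite expg0 mulg1.
have Me g : ~ M g -> M (e * g).
  move=> nMg; have [_ [i [j [-> ]]]] := maxM g nMg.
  have [ij|/ltnW ji] := leqP i j; last first.
    by rewrite -{1}(subnK ji) expgnDr mulgK; apply: MeX.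
  rewrite -{1}(subnK ij) expgnDr invgM mulVKg -expVgn => /MeX MeV.
  have -> : e * g = (e * g^-1) * g ^+ 2 by rewrite expg2 -!mulgA mulKg.
  by apply: MM => //; apply: MeV => /MV; rewrite invgK.
have MeE g : M g -> ~ M (e * g) by move=> Mg /(subgroup_mulr sM _ Mg).
pose chi g := if `[< M g >] then 1 else e.
have chi1 g : M g -> chi g = 1 by rewrite /chi; case: asboolP.
have chie g : M (e * g) -> chi g = e.
  by rewrite /chi; case: asboolP => // /MeE.
exists chi; split=> //.
- move=> x y; have [Mx|/Me Mx] := pselect (M x); have [My|/Me My] := pselect (M y).
  + by rewrite !chi1 ?mulg1 //; apply: MM.
  + rewrite (chi1 x) // !(chie _) // ?mul1g //.
    by rewrite mulgA ce -mulgA; apply: MM.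
  + by rewrite (chi1 y) // !(chie _) // ?mulg1 // mulgA; apply: MM.
  rewrite (chie x) // (chie y) // e2 chi1 //.
  have -> : x * y = (e * x) * (e * y) by rewrite (ce x) -mulgA (mulgA e e) e2 mul1g.
  exact: MM.
- by move=> x; rewrite /chi; case: asboolP; [left|right].
- by apply: chie; rewrite e2.
by move=> x; apply: chi1.
Qed.

End Retractions.

(** * A field inside a group *)

Section Corner.
Local Open Scope group_scope.
Variable G : groupType.
Implicit Types u a b c : G.

(** In a group of invertible upper triangular matrices of size n these are the
    matrices 1 + a e_1n.  The definition does not mention the matrices, so it makes
    sense in every group. *)
Definition corner (x : G) : Prop :=
  (exists g h : G, x = [~ g, h]) /\ forall g h : G, x * [~ g, h] = [~ g, h] * x.

(** In the triangular group, u^g = 1 + c (g_nn / g_11) e_1n when u = 1 + c e_1n, and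
    g_nn / g_11 is multiplicative in g.  The zero of the field is the element 1 of the
    group, which is not a conjugate of u. *)
Definition corner_mul u a b c : Prop :=
  (exists g h : G, a = u ^ g /\ b = u ^ h /\ c = u ^ (g * h)) \/
  ((a = 1 \/ b = 1) /\ c = 1).

(** The field axioms, for the group operation as addition and the graph [corner_mul]
    as multiplication.  Addition is commutative since each corner element is a
    commutator and commutes with all of them. *)
Definition corner_field u : Prop :=
  (corner u /\ u <> 1) /\
  (forall a b, corner a -> corner b -> corner (a * b^-1)) /\
  (forall a b, corner a -> corner b ->
     exists c, corner c /\ corner_mul u a b c /\ forall d, corner_mul u a b d -> d = c) /\
  (forall a b c ab bc abc, corner a -> corner b -> corner c ->
     corner_mul u a b ab -> corner_mul u b c bc -> corner_mul u a bc abc ->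
     corner_mul u ab c abc) /\
  (forall a b ab, corner a -> corner b -> corner_mul u a b ab -> corner_mul u b a ab) /\
  (forall a, corner a -> corner_mul u u a a) /\
  (forall a b c ac bc, corner a -> corner b -> corner c ->
     corner_mul u a c ac -> corner_mul u b c bc -> corner_mul u (a * b) c (ac * bc)) /\
  (forall a, corner a -> a <> 1 -> exists b, corner b /\ corner_mul u b a u).

Lemma corner1 : corner 1.
Proof. by split=> [|g h]; [exists 1, 1; rewrite comm1g | rewrite mul1g mulg1]. Qed.

Lemma cornerC a b : corner a -> corner b -> a * b = b * a.
Proof. by move=> [_ H] [[g [h ->]] _]. Qed.

Section CornerField.
Variable u : G.
Hypothesis uF : corner_field u.

(** The proof of the axioms is an argument so that the ring operations, which depend
    on it, can be attached to the type. *)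
Definition corner_type (_ : corner_field u) : predArgType := {x : G | `[< corner x >]}.
Local Notation L := (corner_type uF).

HB.instance Definition _ := Choice.on L.

Lemma corner_typeP (x : L) : corner (val x).
Proof. exact/asboolP/(valP x). Qed.

Definition corner_of a (ca : corner a) : L := exist _ a (asboolT ca).

Fact corner_cV a : corner a -> corner a^-1.
Proof. by move=> ca; rewrite -[_^-1]mul1g; apply: (uF.2.1) => //; apply: corner1. Qed.

Fact corner_cM a b : corner a -> corner b -> corner (a * b).
Proof.
by move=> ca cb; rewrite -[b]invgK; apply: (uF.2.1) => //; apply: corner_cV.
Qed.

Definition corner_zero : L := corner_of corner1.
Definition corner_one : L := corner_of uF.1.1.
Definition corner_opp (x : L) : L := corner_of (corner_cV (corner_typeP x)).
Definition corner_add (x y : L) : L :=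
  corner_of (corner_cM (corner_typeP x) (corner_typeP y)).

Fact corner_addA : associative corner_add.
Proof. by move=> x y z; apply: val_inj; exact: mulgA. Qed.
Fact corner_addC : commutative corner_add.
Proof. by move=> x y; apply: val_inj; apply: cornerC; exact: corner_typeP. Qed.
Fact corner_add0 : left_id corner_zero corner_add.
Proof. by move=> x; apply: val_inj; exact: mul1g. Qed.
Fact corner_addN : left_inverse corner_zero corner_opp corner_add.
Proof. by move=> x; apply: val_inj; exact: mulVg. Qed.

HB.instance Definition _ := GRing.isZmodule.Build L
  corner_addA corner_addC corner_add0 corner_addN.

Fact corner_mul_exists (x y : L) : exists z : L, corner_mul u (val x) (val y) (val z) /\
  forall d, corner_mul u (val x) (val y) d -> d = val z.
Proof.
have [c [cc cP]] := uF.2.2.1 _ _ (corner_typeP x) (corner_typeP y).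
by exists (corner_of cc).
Qed.

Definition corner_times (x y : L) : L := projT1 (cid (corner_mul_exists x y)).

Lemma corner_timesP (x y : L) : corner_mul u (val x) (val y) (val (corner_times x y)).
Proof. by rewrite /corner_times; case: cid => z []. Qed.

Lemma corner_times_uniq (x y : L) d : corner_mul u (val x) (val y) d ->
  d = val (corner_times x y).
Proof. by rewrite /corner_times; case: cid => z [] /= _; apply. Qed.

Fact corner_timesA : associative corner_times.
Proof.
move=> x y z; apply: val_inj; apply: corner_times_uniq.
apply: (uF.2.2.2.1 _ _ _ _ _ _ (corner_typeP x) (corner_typeP y) (corner_typeP z));
  exact: corner_timesP.
Qed.

Fact corner_timesC : commutative corner_times.
Proof.
move=> x y; apply: val_inj; apply: corner_times_uniq.
by apply: (uF.2.2.2.2.1 _ _ _ (corner_typeP x) (corner_typeP y)); apply: corner_timesP.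
Qed.

Fact corner_times1 : left_id corner_one corner_times.
Proof.
move=> x; apply: val_inj; symmetry; apply: corner_times_uniq.
by apply: (uF.2.2.2.2.2.1 _ (corner_typeP x)).
Qed.

Fact corner_timesD : left_distributive corner_times corner_add.
Proof.
move=> x y z; apply: val_inj; symmetry; apply: corner_times_uniq.
by apply: (uF.2.2.2.2.2.2.1 _ _ _ _ _ (corner_typeP x) (corner_typeP y)
  (corner_typeP z)); apply: corner_timesP.
Qed.

Fact corner_one_neq0 : corner_one != 0%R.
Proof. by apply/eqP => /(congr1 val) /= /(uF.1.2). Qed.

HB.instance Definition _ := GRing.Zmodule_isComNzRing.Build L
  corner_timesA corner_timesC corner_times1 corner_timesD corner_one_neq0.

Fact corner_inv_exists (x : L) : exists y : L, (x != 0%R -> corner_times y x = corner_one) /\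
  (x = 0%R -> y = 0%R).
Proof.
have [->|nx] := eqVneq x 0%R; first by exists 0%R.
have nx1 : val x <> 1 by move=> x1; move/eqP: nx; apply; apply: val_inj.
have [b [cb bx]] := uF.2.2.2.2.2.2.2 _ (corner_typeP x) nx1.
exists (corner_of cb); split=> [_|x0]; last by rewrite x0 eqxx in nx.
by apply: val_inj; symmetry; apply: corner_times_uniq.
Qed.

Definition corner_inv (x : L) : L := projT1 (cid (corner_inv_exists x)).

Fact corner_mulVf (x : L) : x != 0%R -> (corner_inv x * x = 1)%R.
Proof. by rewrite /corner_inv; case: cid => y []. Qed.

Fact corner_inv0 : corner_inv 0%R = 0%R.
Proof. by rewrite /corner_inv; case: cid => y [/= _]; apply. Qed.

HB.instance Definition _ := GRing.ComNzRing_isField.Build L corner_mulVf corner_inv0.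

End CornerField.
End Corner.

(** * Interpreting the field *)

Section CornerDefinable.
Local Open Scope group_scope.

Lemma corner_definable V (t : forall G : groupType, (V -> G) -> G) :
  gterm t -> gdefinable (fun G e => corner (t G e)).
Proof.
move=> dt; apply: (@definable_subst group_language V unit
  (fun G e => corner (e tt)) (fun _ => t)) => //.
by unfold corner, commg, conjg; define_formula.
Qed.

Lemma corner_mul_definable V (t1 t2 t3 t4 : forall G : groupType, (V -> G) -> G) :
  gterm t1 -> gterm t2 -> gterm t3 -> gterm t4 ->
  gdefinable (fun G e => corner_mul (t1 G e) (t2 G e) (t3 G e) (t4 G e)).
Proof.
move=> d1 d2 d3 d4; apply: (@definable_subst group_language V (bool * bool)%type
  (fun G e => corner_mul (e (true, true)) (e (true, false)) (e (false, true))
    (e (false, false)))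
  (fun ij => match ij with (true, true) => t1 | (true, false) => t2
     | (false, true) => t3 | (false, false) => t4 end)) => [|[[] []]] //.
by unfold corner_mul, conjg; define_formula.
Qed.

End CornerDefinable.

Ltac define_corner := intros; first
  [ apply: corner_definable; define_term
  | apply: corner_mul_definable; define_term
  | apply: definable_and; define_corner
  | apply: definable_or; define_corner
  | apply: definable_not; define_corner
  | apply: definable_cond; define_corner
  | apply: definable_eq; define_term
  | apply: definable_imp; define_corner
  | apply: definable_all; define_corner
  | apply: definable_forall_fin; define_corner
  | apply: definable_exists_fin; define_corner
  | apply: definable_forall; define_corner
  | apply: definable_exists; define_corner ].

Section CornerInterp.
Local Open Scope group_scope.

(** A ring R whose elements are coded by the corner elements of G, with the operations
    described above. *)
Definition corner_coords (G : groupType) (p : unit -> G) (R : nzRingType)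
    (C : R -> unit -> G) :=
  [/\ C 0%R tt = 1 /\ C 1%R tt = p tt,
      forall a, C (- a)%R tt = (C a tt)^-1,
      forall a b, C (a + b)%R tt = C a tt * C b tt,
      forall a b x, corner_mul (p tt) (C a tt) (C b tt) x <-> x = C (a * b)%R tt
    & injective C /\ forall x, corner x <-> exists a, x = C a tt].

(** Ring sentences become properties of the group with the single constant u. *)
Lemma corner_interp (f : formula ring_term void) :
  exists D : forall G : groupType, G -> Prop,
    gdefinable (fun G (e : unit -> G) => D G (e tt)) /\
    forall (G : groupType) p (R : nzRingType) C, @corner_coords G p R C ->
      D G (p tt) <-> models (@ring_eval R) f.
Proof.
have [|||D [dD HD]] := @sentence_interp group_language ring_language unit unit
  corner_coords (fun G p x => corner (x tt)) _ _ _ f.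
- by define_corner.
- move=> G p R C [_ _ _ _ [_ CP]] x; rewrite CP; split=> -[a xa]; exists a.
    by apply/funext => -[].
  by rewrite xa.
- move=> V.
  pose E := (unit + (V * unit + unit))%type.
  pose s (v : E) : E + unit := match v with
    inl w => inl (inl w) | inr (inl w) => inl (inr (inl w)) | inr (inr i) => inr i end.
  pose s1 (v : E) : (E + unit) + unit := match v with
    inl w => inl (inl (inl w)) | inr (inl w) => inl (inl (inr (inl w)))
  | inr (inr i) => inl (inr i) end.
  pose s2 (v : E) : (E + unit) + unit := match v with
    inl w => inl (inl (inl w)) | inr (inl w) => inl (inl (inr (inl w)))
  | inr (inr i) => inr i end.
  have CU (G : groupType) p R C : @corner_coords G p R C ->
      forall (x : unit -> G) a, x tt = C a tt <-> x = C a.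
    move=> _ x a; split=> [xa|->] //.
    by apply/funext => -[].
  have CE (G : groupType) p R C : @corner_coords G p R C ->
      forall a b, C a tt = C b tt <-> b = a.
    move=> RC a b; split=> [|->] // ab.
    by have [_ _ _ _ [Cinj _]] := RC; apply: Cinj; apply/funext => -[].
  have CC (G : groupType) p R C : @corner_coords G p R C ->
      forall x : unit -> G, corner (x tt) -> exists a, x = C a.
    move=> RC x; have [_ _ _ _ [_ CP]] := RC.
    by move=> /CP [a xa]; exists a; apply/(CU _ _ _ _ RC).
  have Ccorner (G : groupType) p R C : @corner_coords G p R C ->
      forall a, corner (C a tt).
    by move=> [_ _ _ _ [_ CP]] a; apply/CP; exists a.
  elim=> [v|||t [D [dD HD]]|t [D [dD HD]] r [D' [dD' HD']]|t [D [dD HD]] r [D' [dD' HD']]].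
  + exists (fun G p x y => y tt = x (v, tt)); split; first define_formula.
    by move=> G p R C RC e m; rewrite /coords /= (CE _ _ _ _ RC).
  + exists (fun G p x y => y tt = 1); split; first define_formula.
    move=> G p R C RC e m; have [[<- _] _ _ _ _] := RC.
    by rewrite (CE _ _ _ _ RC).
  + exists (fun G p x y => y tt = p tt); split; first define_formula.
    move=> G p R C RC e m; have [[_ <-] _ _ _ _] := RC.
    by rewrite (CE _ _ _ _ RC).
  + exists (fun (G : groupType) p x y => exists z : unit -> G, corner (z tt) /\
      (D G p x z /\ y tt = (z tt)^-1)); split.
      apply: definable_exists_fin; apply: definable_and; first define_corner.
      apply: definable_and; last define_formula.
      exact: (definable_ext (definable_map s dD)).
    move=> G p R C RC e m; have [_ CN _ _ _] := RC.
    split=> [[z [/(CC _ _ _ _ RC) [a ->] [/(HD _ _ _ _ RC) Da]]]|<-].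
      by rewrite -CN (CE _ _ _ _ RC) => <-; congr (- _)%R.
    exists (C (value e t)); split; first exact: Ccorner RC _.
    by rewrite -CN; split=> //; apply/(HD _ _ _ _ RC).
  + exists (fun (G : groupType) p x y => exists z : unit -> G, exists w : unit -> G,
      corner (z tt) /\ (corner (w tt) /\
      (D G p x z /\ (D' G p x w /\ y tt = z tt * w tt)))); split.
      apply: definable_exists_fin; apply: definable_exists_fin.
      apply: definable_and; first define_corner.
      apply: definable_and; first define_corner.
      apply: definable_and; first exact: (definable_ext (definable_map s1 dD)).
      apply: definable_and; first exact: (definable_ext (definable_map s2 dD')).
      define_formula.
    move=> G p R C RC e m; have [_ _ CD _ _] := RC; split.
      move=> [z [w [/(CC _ _ _ _ RC) [a ->] [/(CC _ _ _ _ RC) [b ->]]]]].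
      move=> [/(HD _ _ _ _ RC) Da [/(HD' _ _ _ _ RC) Db]].
      by rewrite -CD (CE _ _ _ _ RC) => <-; congr (_ + _)%R.
    move=> <-; exists (C (value e t)), (C (value e r)).
    split; first exact: Ccorner RC _.
    split; first exact: Ccorner RC _.
    by rewrite -CD; split; [apply/(HD _ _ _ _ RC)|split=> //; apply/(HD' _ _ _ _ RC)].
  exists (fun (G : groupType) p x y => exists z : unit -> G, exists w : unit -> G,
    corner (z tt) /\ (corner (w tt) /\
    (D G p x z /\ (D' G p x w /\ corner_mul (p tt) (z tt) (w tt) (y tt))))); split.
    apply: definable_exists_fin; apply: definable_exists_fin.
    apply: definable_and; first define_corner.
    apply: definable_and; first define_corner.
    apply: definable_and; first exact: (definable_ext (definable_map s1 dD)).
    apply: definable_and; first exact: (definable_ext (definable_map s2 dD')).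
    define_corner.
  move=> G p R C RC e m; have [_ _ _ CM _] := RC; split.
    move=> [z [w [/(CC _ _ _ _ RC) [a ->] [/(CC _ _ _ _ RC) [b ->]]]]].
    move=> [/(HD _ _ _ _ RC) Da [/(HD' _ _ _ _ RC) Db]].
    by rewrite CM (CE _ _ _ _ RC) => <-; congr (_ * _)%R.
  move=> <-; exists (C (value e t)), (C (value e r)).
  split; first exact: Ccorner RC _.
  split; first exact: Ccorner RC _.
  split; first exact/(HD _ _ _ _ RC).
  by split; [exact/(HD' _ _ _ _ RC)|rewrite CM].
exists (fun G x => D G (fun _ => x)); split.
  apply: (definable_ext dD) => G e.
  by rewrite (_ : (fun=> e tt) = e) //; apply/funext => -[].
move=> G p R C RC; rewrite (_ : (fun=> p tt) = p); first exact: HD RC.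
by apply/funext => -[].
Qed.

Lemma corner_type_coords (G : groupType) (u : G) (uF : corner_field u) :
  @corner_coords G (fun _ => u) (corner_type uF) (fun a _ => val a).
Proof.
split=> //.
  move=> a b x; split=> [/corner_times_uniq|->]; first by apply.
  exact: corner_timesP.
split=> [a b ab|x]; first by apply: val_inj; have := congr1 (fun f => f tt) ab.
split=> [cx|[a ->]]; last exact: corner_typeP.
by exists (corner_of uF cx).
Qed.

(** If a sentence holds in F then G satisfies the group sentence that asserts its
    translation for every corner element u <> 1.  Quantifying over all u is what makes
    one field of H satisfy all sentences of F at the same time. *)
Lemma corner_elem_equiv (F : fieldType) (G H : groupType) (u : H) (uF : corner_field u) :
  (exists v : G, corner v /\ v <> 1) ->
  (forall v : G, corner v -> v <> 1 ->
     exists C, @corner_coords G (fun _ => v) F C) ->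
  group_elem_equiv G H -> ring_elem_equiv (corner_type uF) F.
Proof.
move=> [v0 [cv0 nv0]] coordsG E.
have transfer f : models (@ring_eval F) f -> models (@ring_eval (corner_type uF)) f.
  move=> Ff; have [D [dD HD]] := corner_interp f.
  pose P (K : groupType) := forall v : K, corner v -> v <> 1 -> D K v.
  have dP : gdefinable (fun K (e : void -> K) => P K).
    apply: definable_forall; apply: definable_imp; first define_corner.
    apply: definable_imp; first define_formula.
    exact: (definable_ext (definable_map (fun _ => None) dD)).
  have PG : P G.
    by move=> v cv nv; have [C RC] := coordsG v cv nv; apply/(HD _ _ _ _ RC).
  have := (@elem_equiv_transfer group_language G H P E dP).1 PG u uF.1.1 uF.1.2.
  by move/(HD _ _ _ _ (corner_type_coords uF)).
move=> f; split=> [Lf|]; last exact: transfer.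
by apply: contrapT => nFf; have := transfer (FNot f) nFf; apply.
Qed.

End CornerInterp.

(** * Coordinates on a group *)

Section Coordinates.
Local Open Scope group_scope.
Variable n : nat.
Local Notation I := 'I_n.+1.

Section Entry.
Variable G : groupType.
Variables (u : G) (x y : I -> G).

(** With x_i = 1 + e_1i and y_k = 1 + e_kn in the triangular group, x_i^g is
    1 + e_1 r for the i-th row r of g divided by g_11, and the commutator with y_k
    extracts the k-th component of r and moves it to the corner. *)
Definition entry (i k : I) (g : G) : G := (y k)^-1 * x i ^ g * y k * (x i ^ g)^-1.

Lemma entry_central i k g : g \in @central G -> entry i k g = entry i k 1.
Proof. by move=> /centralP cg; rewrite /entry conjg1 /conjg -(cg (x i)) mulKg. Qed.

(** The words [entry] are the matrix entries of a homomorphism onto the upper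
    triangular matrices with upper left entry 1, over the field of corner elements
    with unit [u], and its kernel is central. *)
Definition coordinates : Prop :=
  corner_field u /\
  (forall g,
    (forall i k, corner (entry i k g)) /\
    (forall i k : I, (k < i)%N -> entry i k g = 1) /\
    (forall i, entry i i g <> 1) /\
    entry ord0 ord0 g = u) /\
  (forall g h i j, exists p : I -> G,
    (forall k, corner_mul u (entry i k g) (entry k j h) (p k)) /\
    entry i j (g * h) = \prod_k p k) /\
  (forall a : I * I -> G, (forall ij, corner (a ij)) ->
    (forall i k : I, (k < i)%N -> a (i, k) = 1) -> (forall i, a (i, i) <> 1) ->
    a (ord0, ord0) = u -> exists g, forall i k, entry i k g = a (i, k)) /\
  (forall g, (forall i k : I, (i != k) -> entry i k g = 1) ->
    (forall i, entry i i g = u) -> forall h, g * h = h * g) /\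
  (forall i k : I, (i != k) -> entry i k 1 = 1) /\
  (forall i : I, entry i i 1 = u).

End Entry.

Definition coordinatizable (G : groupType) : Prop :=
  exists u : G, exists x y : I -> G, coordinates u x y.

Lemma coordinatizable_definable :
  gdefinable (fun G (e : void -> G) => coordinatizable G).
Proof.
by unfold gdefinable, coordinatizable, coordinates, entry, corner_field, conjg;
  define_corner.
Qed.

Section Decomposition.
Variables (H : groupType) (u : H) (x y : I -> H).
Hypothesis uF : corner_field u.
Hypotheses (entry_corner : forall g i k, corner (entry x y i k g))
  (entry_lower : forall g (i k : I), (k < i)%N -> entry x y i k g = 1)
  (entry_diag : forall g i, entry x y i i g <> 1)
  (entry00 : forall g, entry x y ord0 ord0 g = u)
  (entryM : forall g h i j, exists p : I -> H,
    (forall k, corner_mul u (entry x y i k g) (entry x y k j h) (p k)) /\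
    entry x y i j (g * h) = \prod_k p k)
  (entry_onto : forall a : I * I -> H, (forall ij, corner (a ij)) ->
    (forall i k : I, (k < i)%N -> a (i, k) = 1) -> (forall i, a (i, i) <> 1) ->
    a (ord0, ord0) = u -> exists g, forall i k, entry x y i k g = a (i, k))
  (entry_kernel : forall g, (forall i k : I, (i != k) -> entry x y i k g = 1) ->
    (forall i, entry x y i i g = u) -> forall h, g * h = h * g)
  (entry1_off : forall i k : I, (i != k) -> entry x y i k 1 = 1)
  (entry1_diag : forall i : I, entry x y i i 1 = u).
Local Notation L := (corner_type uF).
Hypothesis two_neq0 : (2%:R != 0 :> L)%R.

Let mx (g : H) : 'M[L]_n.+1 :=
  \matrix_(i, k) corner_of uF (entry_corner g i k).

Fact mx_tri g : exists A : tri_group L n.+1, val A = mx g.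
Proof.
apply: exists_tri => [i j ji|i]; rewrite mxE; first by apply: val_inj; apply: entry_lower.
by apply/eqP => /(congr1 val); apply: entry_diag.
Qed.

Let tri g : tri_group L n.+1 := projT1 (cid (mx_tri g)).

Fact val_tri g i k : val (val (tri g) i k) = entry x y i k g.
Proof. by rewrite /tri; case: cid => A /= ->; rewrite mxE. Qed.

Fact tri00 g : val (tri g) ord0 ord0 = 1%R.
Proof. by apply: val_inj; rewrite val_tri entry00. Qed.

Fact triV g i k : val (tri g) i k = nmx (tri g) (i, k).
Proof. by rewrite /nmx /= tri00 divr1. Qed.

Fact val_sum (J : Type) (r : seq J) (F : J -> L) :
  val (\sum_(j <- r) F j)%R = \prod_(j <- r) val (F j).
Proof. by elim/big_rec2: _ => // j a b _ <-. Qed.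

Fact triM_entry : {morph tri : g h / g * h}.
Proof.
move=> g h; apply: val_inj; apply/matrixP => i j; rewrite triM.
apply: val_inj; rewrite val_tri val_sum.
have [p [pP ->]] := entryM g h i j.
apply: eq_bigr => k _; have := pP k.
by rewrite -!val_tri => /corner_times_uniq ->.
Qed.

Fact tri1 : tri 1 = 1.
Proof. by apply: (@mulgI _ (tri 1)); rewrite -triM_entry !mulg1. Qed.

Fact tri_kernel g : tri g = 1 <-> g \in @central H.
Proof.
split=> [g1|cg].
  apply/centralP; apply: entry_kernel => [i k nik|i].
    by rewrite -val_tri g1 -tri1 val_tri entry1_off.
  by rewrite -val_tri g1 -tri1 val_tri entry1_diag.
apply/val_inj/matrixP => i k; apply: val_inj.
rewrite val_tri; transitivity (entry x y i k 1); first exact: entry_central.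
by rewrite -val_tri tri1.
Qed.

Fact tri_onto (A : tri_group L n.+1) : exists g, qpi (tri g) = qpi A.
Proof.
have [n0 n1 nd] := nmx_normalized A.
have [|i k ki|i||g gA] := entry_onto (a := fun ij => val (nmx A ij)).
- by move=> ij; exact: corner_typeP.
- exact: congr1 (n0 i k ki).
- by move=> ai; move/eqP: (nd i); apply; apply: val_inj.
- exact: congr1 n1.
exists g; apply/qpiP/(nmx_same_coset two_neq0)/funext => -[i k].
by rewrite -triV; apply: val_inj; rewrite val_tri gA.
Qed.

(** The coordinates identify the quotient by the center with PT_n of the field, and
    [chi] provides the component in the center. *)
Lemma coordinates_decomposition (chi : H -> H) :
  {morph chi : g h / g * h} -> (forall g, chi g \in @central H) ->
  (forall z, z \in @central H -> chi z = z) ->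
  group_iso H (center_quotient (tri_group L n.+1) * center H)%type.
Proof.
move=> chiM cchi chiZ.
pose f g : (center_quotient (tri_group L n.+1) * center H)%type :=
  (qpi (tri g), Center (cchi g)).
have fM : {morph f : g h / g * h}.
  move=> g h; congr (_, _); first by rewrite triM_entry qpiM.
  by apply: val_inj; rewrite /= chiM.
have f_inj g : qpi (tri g) = qpi 1 -> chi g = 1 -> g = 1.
  move=> /qpiP/(nmx_same_coset two_neq0) E chi1.
  suff /tri_kernel/chiZ <- : tri g = 1 by [].
  apply: val_inj; apply/matrixP => i j; rewrite triV E.
  by rewrite nmx1 mxE.
have chi1 : chi 1 = 1 by apply: (@mulgI _ (chi 1)); rewrite -chiM !mulg1.
apply: (group_iso_of_morph fM) => [g h [Eq Ec]|[q z]].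
  apply: (@mulgI _ g^-1); rewrite mulVg; symmetry; apply: f_inj.
    by rewrite triM_entry qpiM -Eq -qpiM -triM_entry mulVg tri1.
  by rewrite chiM -Ec -chiM mulVg.
have [A ->] := qpi_onto q; have [g gA] := tri_onto A.
have cV : (chi g)^-1 \in @central H.
  by apply: (group_closedV (central_group_closed H)); apply: cchi.
have cz : (chi g)^-1 * val z \in @central H.
  by apply: (group_closedM (central_group_closed H)) => //; apply: (valP z).
exists (g * ((chi g)^-1 * val z)); congr (_, _).
  by rewrite triM_entry ((tri_kernel _).2 cz) mulg1.
by apply: val_inj; rewrite /= chiM (chiZ _ cz) mulVKg.
Qed.

End Decomposition.

Lemma coordinatizable_decomposition (H : groupType) : coordinatizable H ->
  exists (u : H) (uF : corner_field u),
    (2%:R != 0 :> corner_type uF)%R ->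
    (exists chi : H -> H, [/\ {morph chi : g h / g * h},
       forall g, chi g \in @central H & forall z, z \in @central H -> chi z = z]) ->
    group_iso H (center_quotient (tri_group (corner_type uF) n.+1) * center H)%type.
Proof.
move=> [u [x [y [uF [e1 [e2 [e3 [e4 [e5 e6]]]]]]]]]; exists u, uF => two [chi [cM cC cZ]].
apply: (@coordinates_decomposition H u x y uF _ _ _ _ e2 e3 e4 e5 e6 two chi) => //.
- by move=> g; case: (e1 g).
- by move=> g; case: (e1 g) => _ [].
- by move=> g; case: (e1 g) => _ [_ []].
- by move=> g; case: (e1 g) => _ [_ []].
Qed.
End Coordinates.

(** * The coordinates of the triangular group *)

(** The field axioms hold for the corner elements because they hold in F. *)
Lemma corner_coords_field (G : groupType) (p : unit -> G) (F : fieldType)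
    (C : F -> unit -> G) : corner_coords p C -> corner_field (p tt).
Proof.
move=> [[C0 C1] CN CD CM [Cinj CP]].
have Ci a b : C a tt = C b tt -> a = b.
  by move=> ab; apply: Cinj; apply/funext => -[].
have cC a : corner (C a tt) by apply/CP; exists a.
split; first by rewrite -C1 -C0; split=> // /Ci /eqP; rewrite oner_eq0.
split; first by move=> _ _ /CP [a ->] /CP [b ->]; rewrite -CN -CD.
split.
  move=> _ _ /CP [a ->] /CP [b ->]; exists (C (a * b)%R tt); split=> //.
  by split=> [|d]; rewrite CM.
split.
  move=> _ _ _ ab bc abc /CP [a ->] /CP [b ->] /CP [c ->].
  by rewrite !CM => -> ->; rewrite !CM mulrA.
split; first by move=> _ _ ab /CP [a ->] /CP [b ->]; rewrite !CM mulrC.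
split; first by move=> _ /CP [a ->]; rewrite -{1 2}C1 C1 -{2}C1 CM mul1r.
split.
  move=> _ _ _ ac bc /CP [a ->] /CP [b ->] /CP [c ->].
  by rewrite !CM -CD CM mulrDl CD => -> ->.
move=> _ /CP [a ->] na; have {}na : a != 0%R.
  by apply: contra_notN na => /eqP ->.
by exists (C a^-1%R tt); split=> //; rewrite -{2}C1 CM mulVf.
Qed.

Section TriangularCorner.
Local Open Scope ring_scope.
Variables (F : fieldType) (n : nat).
Hypotheses (n_gt0 : (0 < n)%N) (two_neq0 : 2%:R != 0 :> F).
Local Notation T := (tri_group F n.+1).
Local Notation l := (ord_max : 'I_n.+1).
Implicit Types (g h : T) (i j k : 'I_n.+1) (a b v : F).

Fact last_neq0 : (l == 0) = false.
Proof. by rewrite -val_eqE /= gtn_eqF. Qed.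

Lemma mul_row_last g i : delta_mx i l *m val g = val g l l *: delta_mx i l.
Proof.
apply/matrixP => j k; rewrite !mxE (bigD1 l) //= big1 ?addr0; last first.
  by move=> m nm; rewrite mxE (negPf nm) andbF mul0r.
rewrite mxE eqxx andbT; have [->|nk] := eqVneq k l; first by rewrite mulrC andbT.
rewrite andbF mulr0 tri_lower ?mulr0 //.
by rewrite ltn_neqAle -ltnS ltn_ord andbT; apply: contraNneq nk => E; apply/eqP/val_inj.
Qed.

Lemma mul_delta_mid i j k k' (A : 'M[F]_n.+1) :
  delta_mx i j *m A *m delta_mx k k' = A j k *: delta_mx i k'.
Proof.
apply/matrixP => p q; rewrite !mxE (bigD1 k) //= big1 ?addr0; last first.
  by move=> m nm; rewrite [X in _ * X]mxE (negPf nm) mulr0.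
rewrite [X in _ * X]mxE mxE (bigD1 j) //= big1 ?addr0; last first.
  by move=> m nm; rewrite mxE (negPf nm) andbF mul0r.
by rewrite mxE !eqxx andbT mulrAC -natrM mulnb mulrC.
Qed.

Fact conjg_eq (G : groupType) (x g z : G) : (x * g = g * z)%g -> (x ^ g = z)%g.
Proof. by rewrite conjgE => ->; rewrite mulKg. Qed.

Fact exists_tau a : exists B : T, val B = 1%:M + a *: delta_mx 0 l.
Proof. by apply: exists_elementary => //; rewrite eq_sym last_neq0. Qed.

(** The root subgroup of the highest root. *)
Definition tau a : T := projT1 (cid (exists_tau a)).

Lemma val_tau a : val (tau a) = 1%:M + a *: delta_mx 0 l.
Proof. by rewrite /tau; case: cid. Qed.

Lemma tau_inj : injective tau.
Proof.
move=> a b /(congr1 val); rewrite !val_tau => /addrI /matrixP /(_ 0 l).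
by rewrite !mxE !eqxx !mulr1.
Qed.

Lemma tau0 : tau 0 = 1%g.
Proof. by apply: val_inj; rewrite val_tau scale0r addr0. Qed.

Lemma tauD a b : tau (a + b) = (tau a * tau b)%g.
Proof.
apply: val_inj; rewrite [RHS]/= !val_tau mulmxDr mulmx1 mulmxDl mul1mx.
rewrite -scalemxAl -scalemxAr mul_delta_mx_0 ?last_neq0 // !scaler0 addr0.
by rewrite scalerDl addrA.
Qed.

Lemma tauN a : tau (- a) = (tau a)^-1%g.
Proof. by apply: (@mulgI _ (tau a)); rewrite -tauD subrr tau0 mulgV. Qed.

Lemma tau_sum (J : Type) (r : seq J) (f : J -> F) :
  tau (\sum_(j <- r) f j) = (\prod_(j <- r) tau (f j))%g.
Proof. by elim/big_rec2: _ => [|j a b _ <-]; rewrite ?tau0 ?tauD. Qed.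

(** The character by which the triangular group acts on the corner. *)
Definition weight g : F := val g l l / val g 0 0.

Lemma weightM g h : weight (g * h)%g = weight g * weight h.
Proof. by rewrite /weight !tri_diagM mulf_div. Qed.

Lemma tauJ a g : (tau a ^ g)%g = tau (a * weight g).
Proof.
apply: conjg_eq; apply: val_inj; rewrite [LHS]/= [RHS]/= !val_tau.
rewrite mulmxDl mulmxDr mul1mx mulmx1 -scalemxAl -scalemxAr mul_row_last mul_col0.
by rewrite !scalerA -mulrA divfK ?tri_diag_neq0.
Qed.

Lemma exists_weight a : a != 0 -> exists g, weight g = a.
Proof.
move=> na; have [||g Eg] := @exists_elementary F n l l (a - 1) => //.
  by rewrite addrC subrK.
exists g; rewrite /weight Eg !mxE !eqxx eq_sym last_neq0 mulr1 mulr0 addr0 divr1.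
by rewrite addrC subrK.
Qed.

Fact commg_eq (G : groupType) (g h c : G) : (g * h = h * g * c)%g -> ([~ g, h] = c)%g.
Proof. by rewrite commgC => /mulgI. Qed.

(** 1 + e_1j is [1 + e_11, 1 + 2 e_1j], and 1 + e_in is [1 + e_in, 1 + e_nn]. *)
Fact elementary_commutator i j : (i < j)%N -> (i == 0) || (j == l) ->
  exists g h, val [~ g, h]%g = 1%:M + delta_mx i j.
Proof.
move=> ij ijE.
have nij : (i == j) = false by apply/negbTE; rewrite -val_eqE ltn_eqF.
have nji : (j == i) = false by rewrite eq_sym.
have el a : exists B : T, val B = 1%:M + a *: delta_mx i j.
  by apply: exists_elementary; rewrite ?nij // ltnW.
have [c Ec] := el 1; rewrite scale1r in Ec.
case/orP: ijE => [/eqP i0|/eqP jl].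
  have [h Eh] := el 2%:R; have [||g Eg] := @exists_elementary F n i i 1 => //.
  exists g, h; rewrite -Ec; congr val; apply: commg_eq; apply: val_inj.
  rewrite [LHS]/= [RHS]/= Ec Eg Eh scale1r scaler_nat mulr2n.
  rewrite !(mulmxDl, mulmxDr, mulmx1, mul1mx) !mul_delta_mx.
  rewrite !(mul_delta_mx_0, nji) ?nji // !(mul0mx, addr0, add0r).
  by rewrite [in LHS]addrA [in LHS](addrAC _ _ (delta_mx i i)).
have [||h Eh] := @exists_elementary F n j j 1 => //.
exists c, h; rewrite -Ec; congr val; apply: commg_eq; apply: val_inj.
rewrite [LHS]/= [RHS]/= Ec Eh scale1r.
rewrite !(mulmxDl, mulmxDr, mulmx1, mul1mx) !mul_delta_mx.
rewrite !(mul_delta_mx_0, nji) ?nji // !(mul0mx, addr0, add0r).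
by rewrite [in LHS]addrA [in RHS](addrAC _ _ (delta_mx j j)).
Qed.

(** Commutators have diagonal entries 1, so by [tauJ] they centralize the elements
    [tau a], which are themselves commutators.  Conversely, commuting with 1 + e_1j for
    j > 1 and with 1 + e_in for i < n determines all rows but the first and all columns
    but the last. *)
Lemma cornerP (x : T) : corner x <-> exists a, x = tau a.
Proof.
split=> [[[g [h Ex]] cx]|[a ->]]; last first.
  split; last first.
    move=> g h; rewrite [LHS]conjgC tauJ /weight !tri_diagR divr1 mulr1.
    by [].
  have [g wg] := exists_weight two_neq0.
  exists (tau a), g; rewrite commgEl tauJ wg -tauN -tauD.
  by rewrite mulr_natr mulr2n addrA addNr add0r.
have x1 i : val x i i = 1 by rewrite Ex tri_diagR.
have comm i j : (i < j)%N -> (i == 0) || (j == l) ->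
    val x *m delta_mx i j = delta_mx i j *m val x.
  move=> ij ijE; have [g' [h' E]] := elementary_commutator ij ijE.
  have : val x *m val [~ g', h']%g = val [~ g', h']%g *m val x.
    by rewrite -[LHS]/(val (x * [~ g', h'])%g) cx.
  rewrite E.
  by rewrite mulmxDl mulmxDr mul1mx mulmx1 => /addrI.
exists (val x 0 l); apply: val_inj; rewrite val_tau; apply/matrixP => i j.
rewrite !mxE; have [i0|ni0] := eqVneq i 0; last first.
  rewrite mulr0 addr0.
  have := comm 0 i; rewrite lt0n eqxx => /(_ ni0 isT) /matrixP /(_ 0 j).
  rewrite mul_col0 x1 scale1r !mxE eqxx (bigD1 i) //= big1 ?addr0; last first.
    by move=> m nm; rewrite mxE (negPf nm) andbF mul0r.
  by rewrite mxE !eqxx mul1r eq_sym => <-.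
have [jl|njl] := eqVneq j l; first by rewrite i0 jl eq_sym last_neq0 add0r mulr1.
rewrite mulr0 addr0.
have jl : (j < l)%N.
  by rewrite ltn_neqAle -ltnS ltn_ord andbT; apply: contraNneq njl => E; apply/eqP/val_inj.
have := comm j l jl; rewrite eqxx orbT mul_row_last x1 scale1r.
move=> /(_ isT) /matrixP /(_ i l); rewrite !mxE eqxx andbT (bigD1 j) //= big1 ?addr0.
  by rewrite mxE !eqxx mulr1.
by move=> m nm; rewrite mxE (negPf nm) mulr0.
Qed.

(** Any nontrivial [tau v] can serve as the unit: the codes are rescaled by [v]. *)
Lemma tau_coords v : v != 0 ->
  @corner_coords T (fun _ => tau v) F (fun a _ => tau (v * a)).
Proof.
move=> nv; have Cinj a b : tau (v * a) = tau (v * b) -> a = b.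
  by move=> /tau_inj /(mulfI nv).
split; first by rewrite mulr0 tau0 mulr1.
- by move=> a; rewrite mulrN tauN.
- by move=> a b; rewrite mulrDr tauD.
- move=> a b x; split=> [[[g [h []]]|[]]|->].
  + rewrite !tauJ weightM => /tau_inj/(mulfI nv) -> [/tau_inj/(mulfI nv) -> ->].
    by [].
  + move=> ab ->; suff -> : a * b = 0 by rewrite mulr0 tau0.
    apply/eqP; rewrite mulf_eq0; rewrite -tau0 in ab.
    by case: ab => /tau_inj/eqP; rewrite mulf_eq0 (negPf nv) /= => ->; rewrite ?orbT.
  have [a0|na] := eqVneq a 0.
    by right; rewrite a0 mul0r mulr0 tau0; split=> //; left.
  have [b0|nb] := eqVneq b 0.
    by right; rewrite b0 !mulr0 tau0; split=> //; right.
  have [g ga] := exists_weight na; have [h hb] := exists_weight nb.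
  by left; exists g, h; rewrite !tauJ weightM ga hb.
split=> [a b ab|x].
  by apply: Cinj; have := congr1 (fun f => f tt) ab.
rewrite cornerP; split=> -[a ->]; last by eexists.
by exists (v^-1 * a); rewrite mulVKf.
Qed.

Lemma tri_corner_coords (u : T) : corner u -> u <> 1%g ->
  exists C, @corner_coords T (fun _ => u) F C.
Proof.
move=> /cornerP [v ->] nv; exists (fun a _ => tau (v * a)); apply: tau_coords.
by apply: contra_notN nv => /eqP ->; rewrite tau0.
Qed.

Lemma corner_nontrivial : exists u : T, corner u /\ u <> 1%g.
Proof.
exists (tau 1); split; first by apply/cornerP; eexists.
by rewrite -tau0 => /tau_inj/eqP; rewrite oner_eq0.
Qed.

Lemma tri_coordinatizable : coordinatizable n T.
Proof.
have ex i : exists B : T, val B = 1%:M + delta_mx 0 i.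
  by have [||B] := @exists_elementary F n 0 i 1 => //; rewrite scale1r; exists B.
have ey k : exists B : T, val B = 1%:M + delta_mx k l.
  have [||B] := @exists_elementary F n k l 1 => //; last by rewrite scale1r; exists B.
  by rewrite -ltnS ltn_ord.
have [x Ex] := choice ex; have [y Ey] := choice ey.
(* The defining identity is checked as x_i^g y_k = y_k tau(r_k) x_i^g. *)
have entryE i k g : entry x y i k g = tau (nmx g (i, k)).
  rewrite /entry; have [X defX] : exists X, (x i ^ g)%g = X by eexists.
  rewrite defX.
  have EX : val X = 1%:M + (val g 0 0)^-1 *: (delta_mx 0 i *m val g).
    have gX : val g *m val X = val g + delta_mx 0 i *m val g.
      rewrite -[LHS]/(val (g * X)%g) -defX -[(g * _)%g]conjgC.
      by rewrite -[LHS]/(val (x i) *m val g) Ex mulmxDl mul1mx.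
    have /andP [_ ug] := valP g.
    apply: (can_inj (mulKmx ug)); rewrite gX mulmxDr mulmx1 -scalemxAr mulmxA mul_col0.
    by rewrite -scalemxAl scalerA mulVf ?scale1r ?tri_diag_neq0.
  suff XY : (X * y k = y k * tau (nmx g (i, k)) * X)%g.
    by rewrite -(mulgA (y k)^-1%g) XY !mulgA mulVg mul1g mulgK.
  apply: val_inj; rewrite [LHS]/= [RHS]/= EX Ey val_tau.
  rewrite !(mulmxDl, mulmxDr, mulmx1, mul1mx) -!scalemxAl -!scalemxAr mulmxA.
  rewrite mul_delta_mid !mulmxA !mul_delta_mx_0 ?last_neq0 //.
  rewrite !(mul0mx, scaler0, addr0) scalerA [_^-1 * _]mulrC.
  by rewrite -!addrA; congr (_ + (_ + _)); rewrite addrC.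
have FC := @tau_coords 1 (oner_neq0 F).
have tau1F : corner_field (tau 1) := corner_coords_field FC.
have nmxP g : normalized (nmx g) := nmx_normalized g.
exists (tau 1), x, y; split=> //.
split.
  move=> g; have [g0 g1 dg] := nmxP g; split.
    by move=> i k; rewrite entryE; apply/cornerP; eexists.
  split; first by move=> i k ki; rewrite entryE g0 ?tau0.
  split; last by rewrite entryE g1.
  by move=> i; rewrite entryE -tau0 => /tau_inj/eqP; rewrite (negPf (dg i)).
split.
  move=> g h i j; exists (fun k => tau (nmx g (i, k) * nmx h (k, j))); split.
    move=> k; rewrite !entryE; have [_ _ _ CM _] := FC.
    by have := (CM (nmx g (i, k)) (nmx h (k, j)) _).2 erefl; rewrite !mul1r.
  by rewrite entryE nmxM tau_sum.
split.
  move=> a ca la da a00.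
  have /choice [b ab] : forall ij, exists b, a ij = tau b.
    by move=> ij; apply/cornerP.
  have [|g bg] := @normalized_nmx F n b.
    split=> [i j ji||i].
    - by apply: tau_inj; rewrite -ab la ?tau0.
    - by apply: tau_inj; rewrite -ab a00.
    by apply: contra_notN (da i) => /eqP bi; rewrite ab bi tau0.
  by exists g => i k; rewrite entryE ab bg.
split.
  move=> g og dg; apply/centralP; apply/(nmx_central two_neq0) => i j.
  apply: tau_inj; rewrite -entryE; have [->|nij] := eqVneq i j; first exact: dg.
  by rewrite tau0 og.
split=> [i k nik|i]; rewrite entryE nmx1 ?eqxx //.
by rewrite (negPf nik) tau0.
Qed.

Lemma tri_scalar_center :
  exists phi : mul_group F -> T,
    @embedded_onto (fun G x => forall y : G, (x * y = y * x)%g) _ _ phi.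
Proof.
pose phi (a : mul_group F) : T := projT1 (cid (@exists_scalar F n (val a) (valP a))).
exists phi; have val_phi (a : mul_group F) : val (phi a) = (val a)%:M by rewrite /phi; case: cid.
split.
- move=> a b; apply: val_inj; rewrite val_phi [RHS]/= !val_phi.
  by rewrite -scalar_mxM.
- move=> a b /(congr1 val); rewrite !val_phi => /matrixP/(_ 0 0).
  by rewrite !mxE eqxx => /val_inj.
move=> A; split=> [/centralP|[a -> B]].
  rewrite centralE // => /eqP EA; exists (MulGroup (tri_diag_neq0 A 0)).
  by apply: val_inj; rewrite val_phi.
apply: val_inj; rewrite -[LHS]/(val (phi a) *m val B) -[RHS]/(val B *m val (phi a)).
by rewrite val_phi scalar_mxC.
Qed.

(** A scalar matrix is determined by its first diagonal entry, which is 1 for a product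
    of commutators. *)
Lemma tri_commutators_central (x : T) : products (@commutators T) x ->
  x \in @central T -> x = 1%g.
Proof.
move=> [s ->]; rewrite centralE // => /eqP E; apply: val_inj; rewrite E.
suff -> : val (\prod_(p <- s) commutators p)%g 0 0 = 1 by [].
elim: s {E} => [|p s IH]; first by rewrite big_nil tri_diag1.
by rewrite big_cons tri_diagM tri_diagR IH mulr1.
Qed.

(** The first diagonal entry of a product of squares is a square, so it is not -1. *)
Lemma tri_squares_central (x : T) : (forall a : F, a ^+ 2 != -1) ->
  products (@squares T) x -> x \in @central T -> (x ^+ 2 = 1)%g -> x = 1%g.
Proof.
move=> no_sqrt [s Es]; rewrite centralE // => /eqP E x2.
have [a xa] : exists a, val x 0 0 = a ^+ 2.
  rewrite {}Es {E x2}; elim: s => [|y s [a IH]].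
    by exists 1; rewrite big_nil tri_diag1 expr1n.
  by exists (val y 0 0 * a); rewrite big_cons tri_diagM tri_diagM IH exprMn.
apply: val_inj; rewrite E; suff -> : val x 0 0 = 1 by [].
have : val x 0 0 ^+ 2 == 1 by rewrite expr2 -tri_diagM -[(x * x)%g]expg2 x2 tri_diag1.
by rewrite sqrf_eq1 => /orP[/eqP|]; rewrite // xa (negPf (no_sqrt a)).
Qed.

End TriangularCorner.

(** * Transfer and conclusion *)

Section Transfer.
Local Open Scope group_scope.

Lemma group_elem_equiv_transfer (P : groupType -> Prop) (G H : groupType) :
  gdefinable (fun G (e : void -> G) => P G) -> group_elem_equiv G H -> P G -> P H.
Proof. by move=> dP E; apply: (@elem_equiv_transfer group_language G H P E dP).1. Qed.

(** One sentence for each number of factors. *)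
Lemma commutators_central_transfer (G H : groupType) : group_elem_equiv G H ->
  (forall x : G, products (@commutators G) x -> x \in @central G -> x = 1) ->
  forall x : H, products (@commutators H) x -> x \in @central H -> x = 1.
Proof.
move=> E HG _ [s ->] cs; pose m := size s.
pose P (K : groupType) := forall a b : 'I_m -> K,
  (forall y, \prod_(i < m) commutators (a i, b i) * y =
     y * \prod_(i < m) commutators (a i, b i)) ->
  \prod_(i < m) commutators (a i, b i) = 1.
have dP : gdefinable (fun G (e : void -> G) => P G).
  by unfold P, gdefinable, commutators, commg, conjg; define_formula.
have PG : P G.
  move=> a b c; apply: HG; last exact/centralP.
  exists [seq (a i, b i) | i <- index_enum 'I_m].
  by rewrite [RHS]big_map.
have := group_elem_equiv_transfer dP E PG (fun i => (tnth (in_tuple s) i).1)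
  (fun i => (tnth (in_tuple s) i).2).
have -> : \prod_(i < m) commutators ((tnth (in_tuple s) i).1, (tnth (in_tuple s) i).2) =
    \prod_(p <- s) commutators p.
  rewrite [RHS]big_tnth; apply: eq_bigr => i _.
  by case: (tnth _ _).
by apply => y; move/centralP: cs; apply.
Qed.

Lemma squares_central_transfer (G H : groupType) : group_elem_equiv G H ->
  (forall x : G, products (@squares G) x -> x \in @central G -> x ^+ 2 = 1 -> x = 1) ->
  forall x : H, products (@squares H) x -> x \in @central H -> x ^+ 2 = 1 -> x = 1.
Proof.
move=> E HG _ [s ->] cs; pose m := size s.
pose P (K : groupType) := forall a : 'I_m -> K,
  (forall y, \prod_(i < m) squares (a i) * y =
     y * \prod_(i < m) squares (a i)) ->
  (\prod_(i < m) squares (a i)) ^+ 2 = 1 ->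
  \prod_(i < m) squares (a i) = 1.
have dP : gdefinable (fun G (e : void -> G) => P G).
  by unfold P, gdefinable, squares; define_formula.
have PG : P G.
  move=> a c; apply: HG; last exact/centralP.
  exists [seq a i | i <- index_enum 'I_m].
  by rewrite [RHS]big_map.
have := group_elem_equiv_transfer dP E PG (tnth (in_tuple s)).
have -> : \prod_(i < m) squares (tnth (in_tuple s) i) = \prod_(p <- s) squares p.
  by rewrite [RHS]big_tnth.
by apply => y; move/centralP: cs; apply.
Qed.

Definition divisible_group (K : groupType) :=
  forall n, (0 < n)%N -> forall z : K, exists w : K, w ^+ n = z.

Lemma divisible_group_transfer (K K' : groupType) :
  group_elem_equiv K K' -> divisible_group K -> divisible_group K'.
Proof.
move=> E dK n n0.
apply: (group_elem_equiv_transfer (P := fun K => forall z : K, exists w : K, w ^+ n = z)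
  _ E (dK n n0)).
by unfold gdefinable; define_formula.
Qed.

(** The shape of the multiplicative group of a real closed field: the squares form a
    divisible group, and the only involution [e] represents the other class modulo
    squares. *)
Definition sign_times_divisible (K : groupType) :=
  (forall n, (0 < n)%N -> forall z : K, exists w : K, (w ^+ 2) ^+ n = z ^+ 2) /\
  exists e : K, e ^+ 2 = 1 /\ (forall x, x ^+ 2 <> e) /\
    (forall x, x ^+ 2 = 1 -> x = 1 \/ x = e) /\
    forall z, exists w, z = w ^+ 2 \/ z = e * w ^+ 2.

Lemma sign_times_divisible_transfer (K K' : groupType) :
  group_elem_equiv K K' -> sign_times_divisible K -> sign_times_divisible K'.
Proof.
move=> E [dK eK]; split=> [n n0|].
  apply: (group_elem_equiv_transfer
    (P := fun K => forall z : K, exists w : K, (w ^+ 2) ^+ n = z ^+ 2) _ E (dK n n0)).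
  by unfold gdefinable; define_formula.
apply: (group_elem_equiv_transfer (P := fun K : groupType => exists e : K,
    e ^+ 2 = 1 /\ (forall x, x ^+ 2 <> e) /\
    (forall x, x ^+ 2 = 1 -> x = 1 \/ x = e) /\
    forall z, exists w, z = w ^+ 2 \/ z = e * w ^+ 2) _ E eK).
by unfold gdefinable; define_formula.
Qed.

End Transfer.

Section Retract.
Local Open Scope group_scope.
Variable H : groupType.
Hypothesis comm1 : forall x : H, products (@commutators H) x -> x \in @central H -> x = 1.

Definition center_retract := exists chi : H -> H, [/\ {morph chi : g h / g * h},
       forall g, chi g \in @central H & forall z, z \in @central H -> chi z = z].

Fact center_val_exp (z : center H) n : val (z ^+ n) = val z ^+ n.
Proof. exact: gmulfXn. Qed.

Lemma divisible_center_retract : divisible_group (center H) -> center_retract.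
Proof.
move=> dZ.
have [||n z n0 cz||||chi [cM cC cZ]] := @divisible_retraction H
    (fun x => x \in @central H) (products (@commutators H)); last by exists chi.
- have [c1 cF] := central_group_closed H.
  split=> //; first exact: (group_closedM (central_group_closed H)).
  exact: (group_closedV (central_group_closed H)).
- by [].
- have [w wn] := dZ n n0 (Center cz); exists (val w); first exact: (valP w).
  by rewrite -center_val_exp wn.
- exact: commutators_subgroup.
- move=> x y; exact: (products_gen (@commutators H) (x, y)).
- exact: comm1.
Qed.

Hypothesis square1 : forall x : H, products (@squares H) x -> x \in @central H ->
  x ^+ 2 = 1 -> x = 1.

(** The product of the retraction onto the squares of the center and of the retraction
    onto {1, e}.  The second kills squares; the first sends [e] to a square whose square
    is 1, hence to 1 since [e] is not a square. *)
Lemma signed_center_retract : sign_times_divisible (center H) -> center_retract.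
Proof.
move=> [dZ [e [e2 [nse [inv_e sq_e]]]]].
pose P x := exists z : center H, x = val z ^+ 2.
have cP x : P x -> x \in @central H.
  by move=> [z ->]; rewrite -center_val_exp; apply: (valP (z ^+ 2)).
have [||n p n0 [z ->]||||chiP [pM pC pZ]] := @divisible_retraction H P
    (products (@commutators H)).
- split; first by exists 1; rewrite expg2 mulg1.
    move=> _ _ [z ->] [w ->]; exists (z * w); rewrite -!center_val_exp.
    rewrite expgMn //; apply: val_inj; exact: (centralP _ (valP z)).
  by move=> _ [z ->]; exists z^-1; rewrite -!center_val_exp expVgn.
- exact: cP.
- have [w wn] := dZ n n0 z; exists (val w ^+ 2); first by exists w.
  by rewrite -!center_val_exp wn.
- exact: commutators_subgroup.
- move=> x y; exact: (products_gen (@commutators H) (x, y)).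
- by move=> x Nx /cP; apply: comm1.
have [|||chiE [eM eC eE eS]] := @involution_retraction H (val e).
- exact: (valP e).
- by rewrite -center_val_exp e2.
- move=> /square1 e1; apply: (nse 1); rewrite expg2 mulg1; apply: val_inj.
  by rewrite e1 //; [exact: (valP e)|rewrite -center_val_exp e2].
have cchiE g : chiE g \in @central H.
  by case: (eC g) => ->; [case: (central_group_closed H)|exact: (valP e)].
exists (fun g => chiE g * chiP g); split.
- move=> g h; rewrite eM pM !mulgA; congr (_ * _); rewrite -!mulgA; congr (_ * _).
  exact: (centralP _ (cchiE h)).
- by move=> g; apply: (group_closedM (central_group_closed H)) => //; apply/cP/pC.
have PE : chiP (val e) = 1.
  have [w Ew] := pC (val e).
  have : (w ^+ 2) ^+ 2 = 1.
    apply: val_inj; rewrite !center_val_exp -Ew expg2 -pM -[val e * _]expg2.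
    rewrite -center_val_exp e2; apply: (@mulgI _ (chiP 1)).
    by rewrite -pM !mulg1.
  move=> /inv_e [w1|/nse //]; rewrite Ew -center_val_exp w1 //.
have fixsq (w : center H) : chiE (val w ^+ 2) * chiP (val w ^+ 2) = val w ^+ 2.
  by rewrite eS mul1g pZ //; exists w.
move=> z cz; have [w] := sq_e (Center cz).
rewrite -[z]/(val (Center cz)); case=> ->; first by rewrite center_val_exp.
rewrite -[val (e * _)]/(val e * val (w ^+ 2)) center_val_exp eM pM PE eE mul1g.
by rewrite -mulgA fixsq.
Qed.

End Retract.

Section FieldFacts.
Import Order.TTheory Num.Theory.
Local Open Scope ring_scope.

(** The intermediate value theorem for X^n - a between 0 and 1 + a. *)
Lemma real_closed_root (R : rcfType) (n : nat) (a : R) : (0 < n)%N -> 0 < a ->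
  exists2 x : R, 0 < x & x ^+ n = a.
Proof.
move=> n0 a0; pose p : {poly R} := 'X^n - a%:P.
have a1 : 1 <= 1 + a by rewrite lerDl ltW.
have [||x /andP [x0 _] /rootP] := @poly_ivt R p 0 (1 + a).
- exact: le_trans ler01 a1.
- rewrite !hornerE expr0n eqn0Ngt n0 /= sub0r oppr_le0 ltW //= subr_ge0.
  by apply: le_trans (ler_eXnr n0 a1); rewrite lerDr ler01.
rewrite !hornerE => /eqP; rewrite subr_eq0 => /eqP xa.
exists x => //; rewrite lt_def x0 andbT; apply: contraTneq a0 => x00.
by rewrite -xa x00 expr0n eqn0Ngt n0 ltxx.
Qed.

Variable F : fieldType.

Lemma mul_group_val_exp (z : mul_group F) n : val (z ^+ n)%g = val z ^+ n.
Proof. by elim: n => // n IH; rewrite expgS exprS -IH. Qed.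

Lemma closed_divisible : algebraically_closed F -> divisible_group (mul_group F).
Proof.
move=> cF n n0 z; have [x xn] := cF n (fun i => if i == 0%N then val z else 0) n0.
have xz : x ^+ n = val z.
  rewrite xn -(prednK n0) big_ord_recl /= expr0 mulr1 big1 ?addr0 // => i _.
  by rewrite mul0r.
have nx : x != 0.
  by apply: contraNneq (valP z) => x0; rewrite -xz x0 expr0n eqn0Ngt n0.
by exists (MulGroup nx); apply: val_inj; rewrite mul_group_val_exp.
Qed.

Hypothesis rF : real_closed F.

Lemma real_closed_two : 2%:R != 0 :> F.
Proof.
have [R [f bf]] := rF.
by rewrite -(inj_eq (bij_inj bf)) rmorph0 rmorph_nat pnatr_eq0.
Qed.

Lemma real_closed_no_sqrt (a : F) : a ^+ 2 != -1.
Proof.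
have [R [f bf]] := rF.
rewrite -(inj_eq (bij_inj bf)) rmorphXn rmorphN rmorph1.
apply/eqP => E; have := sqr_ge0 (f a); rewrite E oppr_ge0.
by rewrite leNgt ltr01.
Qed.

Lemma real_closed_mul_group : sign_times_divisible (mul_group F).
Proof.
have [R [f bf]] := rF; have [g fK gK] := bf; have finj := bij_inj bf.
have root n (a : F) : (0 < n)%N -> 0 < f a -> exists2 w : mul_group F,
    0 < f (val w) & val w ^+ n = a.
  move=> n0 a0; have [x x0 xn] := real_closed_root n0 a0.
  have nx : g x != 0.
    by apply: contraTneq x0 => gx; rewrite -(gK x) gx rmorph0 ltxx.
  exists (MulGroup nx); rewrite /= ?gK //.
  by apply: finj; rewrite rmorphXn /= gK xn.
have f0 (z : mul_group F) : f (val z) != 0 by rewrite fmorph_eq0 (valP z).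
have sgn (z : mul_group F) : 0 < f (val z) \/ 0 < f (- val z).
  by rewrite rmorphN oppr_gt0; case: (ltgtP (f (val z)) 0) (f0 z) => //; [right|left].
split=> [n n0 z|].
  have [w wn] : exists w : mul_group F, (val w ^+ n) ^+ 2 = val z ^+ 2.
    have [z0|z0] := sgn z; have [w _ wn] := root n _ n0 z0; exists w; rewrite wn //.
    by rewrite sqrrN.
  exists w; apply: val_inj; rewrite !mul_group_val_exp -wn.
  by rewrite exprAC.
have n1 : -1 != 0 :> F by rewrite oppr_eq0 oner_neq0.
exists (MulGroup n1); split.
  by apply: val_inj; rewrite mul_group_val_exp /= sqrrN expr1n.
split.
  move=> x /(congr1 val); rewrite mul_group_val_exp /= => /eqP.
  by rewrite (negPf (real_closed_no_sqrt _)).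
split.
  move=> x /(congr1 val); rewrite mul_group_val_exp /= => /eqP.
  by rewrite sqrf_eq1 => /orP[]/eqP xE; [left|right]; apply: val_inj.
move=> z; have [z0|z0] := sgn z; have [w _ wn] := root 2%N _ isT z0; exists w.
  by left; apply: val_inj; rewrite mul_group_val_exp wn.
right; apply: val_inj; rewrite -[RHS]/(-1 * val (w ^+ 2)%g).
by rewrite mul_group_val_exp wn mulN1r opprK.
Qed.

End FieldFacts.

Theorem theorem5p13 (n : nat) (F : fieldType) (H : groupType) :
  (3 <= n)%N ->
  (real_closed F \/ (algebraically_closed F /\ 2%N \notin [pchar F]%R)) ->
  (group_elem_equiv (tri_group F n) H
   <->
   (exists L : fieldType,
      ring_elem_equiv L F /\ group_iso H (center_quotient (tri_group L n) * center H)%type)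
   /\ group_elem_equiv (center H) (mul_group F)).
Proof.
case: n => [//|n] n2 FF; have n_gt0 : (0 < n)%N by case: n n2.
have two_neq0 : (2%:R != 0 :> F)%R.
  by case: FF => [/real_closed_two //|[_]]; rewrite inE.
split=> [E|[[L [EL iH]] EZ]]; last exact: equiv_of_iso EL iH EZ.
have EZ : group_elem_equiv (center H) (mul_group F).
  have [phi phiP] := tri_scalar_center n two_neq0.
  have valP' : embedded_onto (fun G (x : G) => forall y : G, x * y = y * x)%g
      (fun z : center H => val z).
    split=> // [|y]; first exact: val_inj.
    split=> [cy|[z -> h]]; first by exists (Center (introT (centralP y) cy)).
    exact: (centralP _ (valP z)).
  apply: (embedded_onto_elem_equiv _ valP' phiP).
    by unfold gdefinable; define_formula.
  by move=> f; split=> /E.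
split=> //.
have EZ' : group_elem_equiv (mul_group F) (center H) by move=> f; split=> /EZ.
have cH : coordinatizable n H.
  apply: (group_elem_equiv_transfer _ E); last exact: tri_coordinatizable.
  exact: coordinatizable_definable.
have [u [uF dec]] := coordinatizable_decomposition cH.
have EL : ring_elem_equiv (corner_type uF) F.
  apply: (corner_elem_equiv uF _ _ E); first exact: corner_nontrivial.
  exact: tri_corner_coords.
exists (corner_type uF); split=> //; apply: dec.
  exact: ring_elem_equiv_two EL two_neq0.
have comm1 := commutators_central_transfer E (tri_commutators_central two_neq0).
case: FF => [rF|[cF _]].
  apply: (signed_center_retract comm1); last first.
    exact: sign_times_divisible_transfer EZ' (real_closed_mul_group rF).
  apply: (squares_central_transfer E) => x sx cx.
  exact: (tri_squares_central two_neq0 (real_closed_no_sqrt rF) sx cx).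
apply: (divisible_center_retract comm1).
exact: divisible_group_transfer EZ' (closed_divisible cF).
Qed.
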